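(* Let $w\in S_n$. The Schubert polynomial of $w$ is given by $$\mathfrak{S}_w=\sum_{T\in\mathcal{IT}(w)}x^{wt(T)},$$ where the sum is over all inversions tableaux $T$ of shape $w$.
   Context: Permutations $w\in S_n$ are written in one-line notation $w=w_1w_2\cdots w_n$. $\mathrm{Inv}(w)=\{(i,j): 1\le i<j\le n,\ w_j<w_i\}$ and $l(w)=\#\mathrm{Inv}(w)$. Schubert polynomials: let $\partial_i(f)=\frac{f-s_i(f)}{x_i-x_{i+1}}$, where $s_i(f)$ is obtained from the polynomial $f$ by swapping $x_i\leftrightarrow x_{i+1}$. The Schubert polynomials $\mathfrak{S}_w$, $w\in S_n$, are uniquely determined by $\mathfrak{S}_{w_0}=x_1^{n-1}x_2^{n-2}\cdots x_{n-1}$, where $w_0=n(n-1)\cdots 21$, and $\partial_i\mathfrak{S}_w=\mathfrak{S}_{ws_i}$ if $l(ws_i)<l(w)$ and $\partial_i\mathfrak{S}_w=0$ otherwise, where $ws_i$ is obtained from $w$ by swapping the entries in positions $i$ and $i+1$. Inversions tableaux: the staircase consists of the boxes $(i,j)$ with $1\le i<j\le n$, where $i$ is the row index and $j$ the column index; rows are drawn with index increasing from bottom to top and columns with index increasing from left to right. The inversions diagram of $w$ is the staircase in which box $(i,j)$ is shaded exactly when $(i,j)\in\mathrm{Inv}(w)$. An inversions tableau of shape $w$ is an assignment $T$ of a number $T(i,j)\in\{1,\dots,n\}$ to each shaded box of the inversions diagram of $w$, with $T(i,j)=0$ for every unshaded box, such that: (IT1) $T$ is weakly balanced: for all $i<j$,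 $T(i,j)$ is the median (counting multiplicities) of the entries of $T$ in the hook $\{(i,j)\}\cup\{(i',j): i<i'<j\}\cup\{(i,j'): i<j'<j\}$; (IT2) no two shaded boxes in the same column have the same entry; (IT3) $T(i,i+1)\le i$ for all $1\le i<n$. $\mathcal{IT}(w)$ is the set of inversions tableaux of shape $w$. The weight of $T$ is $wt(T)=(m_1,\dots,m_{n-1})$, where $m_i$ is the number of boxes with entry $i$ (zeros are not counted), and $x^{wt(T)}=x_1^{m_1}\cdots x_{n-1}^{m_{n-1}}$. *)

(* Defs.v *)
From mathcomp Require Import all_boot all_order all_fingroup all_algebra.
From mathcomp Require Import zify ring.
From mathcomp Require Import mpoly.

Set Implicit Arguments.
Unset Strict Implicit.
Unset Printing Implicit Defensive.

Import GRing.Theory.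
Local Open Scope ring_scope.

(* Positions, values and variables are indexed from 0 (by 'I_n), so w : 'S_n
   has one-line notation (w 0).+1 ... (w n.-1).+1, and 'X_i stands for
   x_{i+1}.  Entries of tableaux, on the other hand, keep their values in
   {0, ..., n}. *)

Definition inversion n (w : 'S_n) (i j : 'I_n) : bool := ((i < j) && (w j < w i))%N.

Definition Inv n (w : 'S_n) : {set 'I_n * 'I_n} := [set p | inversion w p.1 p.2].

Definition len n (w : 'S_n) : nat := #|Inv w|.

Definition w0 n : 'S_n := perm (@rev_ord_inj n).

(* The permutation w s_i when j = i.+1: since (s * t) k = t (s k) for
   permutations, the entries in positions i and j are swapped by multiplying
   with tperm i j on the left. *)
Definition swap_pos n (i j : 'I_n) (w : 'S_n) : 'S_n := (tperm i j * w)%g.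

Section Quotients.
Variables (R : comNzRingType) (s t : R -> R).
Hypotheses (sB : {morph s : x y / x - y}) (sM : {morph s : x y / x * y}).
Hypotheses (tB : {morph t : x y / x - y}) (tM : {morph t : x y / x * y}).

Lemma quot_commute a b f p q pq qp : s b = b -> t a = a ->
  s (t f) = t (s f) -> a * p = f - s f -> b * q = f - t f ->
  a * pq = q - s q -> b * qp = p - t p -> b * (a * pq) = b * (a * qp).
Proof.
move=> sb ta st ep eq epq eqp.
have e1 : b * s q = s f - s (t f) by rewrite -{1}sb -sM eq sB.
have e2 : a * t p = t f - t (s f) by rewrite -{1}ta -tM ep tB.
by rewrite epq mulrBr eq e1 mulrCA eqp mulrBr ep e2 st; ring.
Qed.

Lemma quot_braid a b c f g1 g2 g3 :
  s a = b -> s b = a -> s c = c -> t a = a -> t b = c -> t c = b ->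
  s g1 = g1 ->
  (a - b) * g1 = f - s f -> (b - c) * g2 = g1 - t g1 ->
  (a - b) * g3 = g2 - s g2 ->
  (a - b) * (b - c) * (a - c) * g3 =
  f - s f - t f + t (s f) + s (t f) - s (t (s f)).
Proof.
move=> sa sb sc ta tb tc sg e1 e2 e3.
have := congr1 s e2; rewrite sM !sB sb sc sg => e5.
have := congr1 t e1; rewrite tM !tB ta tb => e6.
have := congr1 s e6; rewrite sM !sB sa sc => e7.
have -> : (a - b) * (b - c) * (a - c) * g3 =
          (b - c) * (a - c) * ((a - b) * g3) by ring.
rewrite e3.
have -> : (b - c) * (a - c) * (g2 - s g2) =
  (a - c) * ((b - c) * g2) - (b - c) * ((a - c) * s g2) by ring.
rewrite e2 e5.
have -> : (a - c) * (g1 - t g1) - (b - c) * (g1 - s (t g1)) =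
  (a - b) * g1 - (a - c) * t g1 + (b - c) * s (t g1) by ring.
rewrite e1 e6 e7; ring.
Qed.

Lemma quot_prod a f1 f2 g1 g2 : a * g1 = f1 - s f1 -> a * g2 = f2 - s f2 ->
  a * (g1 * f2 + s f1 * g2) = f1 * f2 - s (f1 * f2).
Proof. by move=> e1 e2; rewrite mulrDr mulrA e1 mulrCA e2 sM; ring. Qed.

End Quotients.

Lemma quot_braid_end (R : idomainType) (a b c x y y' f1 f2 f3 f4 f5 f6 : R) :
  a - b != 0 -> b - c != 0 -> a - c != 0 ->
  (a - b) * (b - c) * (a - c) * x = f1 - f2 - f3 + f4 + f5 - f6 ->
  (c - b) * (b - a) * (c - a) * y' =
    f1 - f3 - f2 + f5 + f4 - f6 -> y = - y' -> x = y.
Proof.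
move=> ab bc ac ex ey ->.
apply: (mulfI (mulf_neq0 (mulf_neq0 ab bc) ac)).
rewrite ex mulrN -mulNr.
have -> : - ((a - b) * (b - c) * (a - c)) = (c - b) * (b - a) * (c - a) by ring.
by rewrite ey; ring.
Qed.

Section DividedDifference.
Variable n : nat.
Implicit Types (i j : 'I_n) (f g : {mpoly int[n]}).

Lemma msymXU (s : 'S_n) i : msym s ('X_i : {mpoly int[n]}) = 'X_(s i).
Proof. by rewrite /msym mmapX mmap1U. Qed.

Lemma divdiff_exists i j f :
  exists g, ('X_i - 'X_j) * g == f - msym (tperm i j) f.
Proof.
pose P f := exists g, ('X_i - 'X_j) * g == f - msym (tperm i j) f.
have PM f1 f2 : P f1 -> P f2 -> P (f1 * f2).
  move=> [g1 /eqP e1] [g2 /eqP e2].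
  exists (g1 * f2 + msym (tperm i j) f1 * g2); apply/eqP.
  exact: (quot_prod (msymM (tperm i j)) e1 e2).
have PX k : P 'X_k.
  rewrite /P msymXU; case: tpermP => [->|->|_ _].
  - by exists 1; rewrite mulr1.
  - by exists (- 1); rewrite mulrN1 opprB.
  - by exists 0; rewrite mulr0 subrr.
have P1 : P 1 by exists 0; rewrite msym1 mulr0 subrr.
elim/mpolyind: f => [|c m p _ _ [g /eqP eg]].
  by exists 0; rewrite msym0 mulr0 subrr.
have [h /eqP eh] : P 'X_[m].
  rewrite mpolyXE_id; apply: (big_ind P) => [||k _]; [exact: P1|exact: PM|].
  by elim: (m k) => [|d IHd]; [exact: P1|rewrite exprS; exact: PM].
exists (c *: h + g); apply/eqP.
rewrite msymD msymZ mulrDr -scalerAr eh eg scalerBr.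
by rewrite opprD addrACA.
Qed.

(* The quotient (f - s f) / (x_i - x_j) where s swaps x_i and x_j; it is unique
   for i != j because {mpoly int[n]} is an integral domain. *)
Definition divdiff i j f : {mpoly int[n]} := xchoose (divdiff_exists i j f).

Lemma divdiffE i j f :
  ('X_i - 'X_j) * divdiff i j f = f - msym (tperm i j) f.
Proof. exact/eqP/(xchooseP (divdiff_exists i j f)). Qed.

Local Opaque divdiff.

Lemma subX_neq0 i j : i != j -> 'X_i - 'X_j != 0 :> {mpoly int[n]}.
Proof.
move=> ij; rewrite subr_eq0; apply/eqP => /(congr1 (mcoeff U_(i)%MM)).
by rewrite !mcoeffXU eqxx eq_sym (negPf ij).
Qed.

Lemma divdiff_uniq i j f g : i != j ->
  ('X_i - 'X_j) * g = f - msym (tperm i j) f -> divdiff i j f = g.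
Proof. by move=> ij e; apply: (mulfI (subX_neq0 ij)); rewrite divdiffE e. Qed.

Lemma divdiff_sym i j f : i != j ->
  msym (tperm i j) (divdiff i j f) = divdiff i j f.
Proof.
move=> ij; apply/esym/divdiff_uniq => //.
have := congr1 (msym (tperm i j)) (divdiffE i j f).
rewrite msymM !msymB !msymXU tpermL tpermR -msymMm tperm2 msym1m => e.
by rewrite -[LHS]opprK -mulNr opprB e opprB.
Qed.

Lemma divdiff_id i j f : i != j -> divdiff i j (divdiff i j f) = 0.
Proof.
by move=> ij; apply: divdiff_uniq => //; rewrite divdiff_sym // mulr0 subrr.
Qed.

Lemma tperm_commute i j k l :
  i != j -> k != l -> i != k -> i != l -> j != k -> j != l ->
  (tperm i j * tperm k l = tperm k l * tperm i j)%g.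
Proof.
move=> ij kl ik il jk jl; apply/commgP/conjg_fixP.
by rewrite tpermJ !tpermD // eq_sym.
Qed.

Lemma divdiff_commute i j k l f :
  i != j -> k != l -> i != k -> i != l -> j != k -> j != l ->
  divdiff i j (divdiff k l f) = divdiff k l (divdiff i j f).
Proof.
move=> ij kl ik il jk jl.
have st := tperm_commute ij kl ik il jk jl.
apply: (mulfI (subX_neq0 ij)); apply: (mulfI (subX_neq0 kl)).
apply: (quot_commute (s := msym (tperm i j)) (t := msym (tperm k l))
  (msymB _) (msymM _) (msymB _) (msymM _) _ _ _ (divdiffE i j f)
  (divdiffE k l f) (divdiffE i j _) (divdiffE k l _)).
- by rewrite msymB !msymXU !tpermD.
- by rewrite msymB !msymXU !tpermD // eq_sym.
- by rewrite -!msymMm st.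
Qed.

Lemma divdiff_prod3 i j k f : i != j -> i != k -> j != k ->
  let s := msym (tperm i j) in let t := msym (tperm j k) in
  ('X_i - 'X_j) * ('X_j - 'X_k) * ('X_i - 'X_k) *
    divdiff i j (divdiff j k (divdiff i j f)) =
  f - s f - t f + t (s f) + s (t f) - s (t (s f)).
Proof.
move=> ij ik jk s t.
apply: (quot_braid (msymB _) (msymM _) (msymB _) (msymM _)
  _ _ _ _ _ _ _ (divdiffE i j f) (divdiffE j k _) (divdiffE i j _)).
all: rewrite /s /t ?msymXU ?tpermL ?tpermR ?divdiff_sym //.
all: by rewrite tpermD // eq_sym.
Qed.

Lemma tperm_braid i j k : i != j -> i != k -> j != k ->
  (tperm i j * tperm j k * tperm i j = tperm j k * tperm i j * tperm j k)%g.
Proof.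
move=> ij ik jk.
have -> : (tperm i j * tperm j k * tperm i j = tperm i k)%g.
  by rewrite -mulgA -{1}[tperm i j]tpermV -conjgE tpermJ tpermR tpermD.
rewrite -mulgA -{1}[tperm j k]tpermV -conjgE tpermJ tpermL tpermD //.
  by rewrite eq_sym.
by rewrite eq_sym.
Qed.

Lemma divdiff_anti i j f : i != j -> divdiff j i f = - divdiff i j f.
Proof.
move=> ij; apply: divdiff_uniq; first by rewrite eq_sym.
by rewrite mulrN -mulNr opprB divdiffE tpermC.
Qed.

Lemma divdiffN i j f : i != j -> divdiff i j (- f) = - divdiff i j f.
Proof.
by move=> ij; apply: divdiff_uniq => //; rewrite mulrN divdiffE msymN opprB opprK addrC.
Qed.

Lemma divdiff_braid i j k f : i != j -> i != k -> j != k ->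
  divdiff i j (divdiff j k (divdiff i j f)) =
  divdiff j k (divdiff i j (divdiff j k f)).
Proof.
move=> ij ik jk.
have kj : k != j by rewrite eq_sym.
have ki : k != i by rewrite eq_sym.
have ji : j != i by rewrite eq_sym.
have E1 := divdiff_prod3 f ij ik jk; have E2 := divdiff_prod3 f kj ki ji.
apply: (quot_braid_end (subX_neq0 ij) (subX_neq0 jk) (subX_neq0 ik)
  E1 (y' := divdiff k j (divdiff j i (divdiff k j f)))); last first.
  rewrite (divdiff_anti f jk) (divdiffN _ ji) (divdiff_anti _ ij).
  by rewrite [X in divdiff k j X]opprK (divdiff_anti _ jk) [RHS]opprK.
move: E2; rewrite (tpermC k j) (tpermC j i) => ->.
by rewrite -!msymMm tperm_braid.
Qed.

End DividedDifference.

Definition is_schubert_family n (S : {ffun 'S_n -> {mpoly int[n]}}) : bool :=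
  (S (w0 n) == \prod_(i < n) 'X_i ^+ (n - i.+1)) &&
  [forall w : 'S_n, forall i : 'I_n, forall j : 'I_n,
    (j == i.+1 :> nat) ==>
    (divdiff i j (S w) ==
       if (len (swap_pos i j w) < len w)%N then S (swap_pos i j w) else 0)].

Section SchubertExists.
Variable n : nat.
Implicit Types (i j k l : 'I_n) (w v : 'S_n).

Lemma adj_neq i j : j = i.+1 :> nat -> i != j.
Proof. by move=> e; apply/eqP => ij; move: e; rewrite ij; lia. Qed.

Lemma swap_posE i j w (k : 'I_n) : swap_pos i j w k = w (tperm i j k).
Proof. by rewrite permM. Qed.

Lemma swap_posK i j w : swap_pos i j (swap_pos i j w) = w.
Proof. by rewrite /swap_pos mulgA tperm2 mul1g. Qed.

Lemma len_swap_asc i j w : j = i.+1 :> nat -> (w i < w j)%N ->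
  (len w < len (swap_pos i j w))%N.
Proof.
move=> ij wij; have nij := adj_neq ij.
pose h (p : 'I_n * 'I_n) := (tperm i j p.1, tperm i j p.2).
have hI : injective h.
  by move=> [a b] [c d] []; rewrite /= => /perm_inj -> /perm_inj ->.
rewrite /len -(card_imset _ hI); apply/proper_card/properP; split.
  apply/subsetP => x /imsetP[[a b]]; rewrite inE /inversion /= => /andP[ab wba] ->.
  rewrite inE /inversion /= !swap_posE !tpermK wba andbT.
  move: ab wba; case: tpermP => [->|->|/eqP + /eqP +];
    case: tpermP => [->|->|/eqP + /eqP +]; rewrite -?val_eqE /=; lia.
exists (i, j).
  by rewrite inE /inversion /= !swap_posE tpermL tpermR wij ij leqnn.
apply/imsetP => -[[a b]]; rewrite inE /inversion /= => /andP[ab _] [ea eb].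
have eai : a = j by rewrite -[a](tpermK i j) -ea tpermL.
have ebj : b = i by rewrite -[b](tpermK i j) -eb tpermR.
by move: ab; rewrite eai ebj; lia.
Qed.

Lemma len_swap i j w : j = i.+1 :> nat ->
  (len (swap_pos i j w) < len w)%N = (w j < w i)%N.
Proof.
move=> ij; case: (ltngtP (w i) (w j)) => [lt|gt|eq].
- by have := len_swap_asc ij lt; lia.
- have := @len_swap_asc i j (swap_pos i j w) ij.
  by rewrite swap_posK !swap_posE tpermL tpermR; apply.
- by have := adj_neq ij; rewrite (perm_inj (val_inj eq)) eqxx.
Qed.

Lemma len_max w : (len w <= n * n)%N.
Proof. by rewrite (leq_trans (max_card _)) // card_prod card_ord. Qed.

Lemma no_asc_w0 w :
  (forall i j, j = i.+1 :> nat -> (w j < w i)%N) -> w = w0 n.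
Proof.
move=> H.
have le m i : i = m :> nat -> (w i + m < n)%N.
  elim: m i => [|m IH] i im; first by rewrite addn0.
  have mn : (m < n)%N by apply: leq_trans (ltn_ord i); lia.
  by have := IH (Ordinal mn) erefl; have := H (Ordinal mn) i im; lia.
have ge m i : (i + m).+1 = n -> (m <= w i)%N.
  elim: m i => [//|m IH] i im.
  have mn : (i.+1 < n)%N by lia.
  have := IH (Ordinal mn); have := H i (Ordinal mn) erefl => /=; lia.
apply/permP => i; rewrite permE; apply: val_inj => /=.
by have := le _ i erefl; have := ge (n - i.+1)%N i; have := ltn_ord i; lia.
Qed.

Lemma w0_desc i j : j = i.+1 :> nat -> (w0 n j < w0 n i)%N.
Proof. by move=> ij; rewrite !permE /=; have := ltn_ord j; lia. Qed.

Inductive reach : 'S_n -> {mpoly int[n]} -> Prop :=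
| reach_w0 : reach (w0 n) (\prod_(i < n) 'X_i ^+ (n - i.+1))
| reach_asc i j w f : j = i.+1 :> nat -> (w i < w j)%N ->
    reach (swap_pos i j w) f -> reach w (divdiff i j f).

Lemma reach_total w : exists f, reach w f.
Proof.
have [m] := ubnP (n * n - len w)%N; elim: m w => // m IH w lt.
have [|none] := boolP [exists p : 'I_n * 'I_n,
    (p.2 == p.1.+1 :> nat) && (w p.1 < w p.2)%N].
  case/existsP => -[i j] /= /andP[/eqP ij wij].
  have := len_swap_asc ij wij; have := len_max (swap_pos i j w) => l1 l2.
  have [|f rf] := IH (swap_pos i j w); first by lia.
  by exists (divdiff i j f); apply: reach_asc rf.
have -> : w = w0 n; last by exists (\prod_(i < n) 'X_i ^+ (n - i.+1)); left.
apply: no_asc_w0 => i j ij; rewrite ltnNge leq_eqVlt negb_or.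
apply/andP; split.
  by apply: contra (adj_neq ij) => /eqP/val_inj/perm_inj ->.
move: none; rewrite negb_exists => /forallP /(_ (i, j)) /=.
by rewrite ij eqxx.
Qed.

Lemma reach_inv w f : reach w f ->
  (w = w0 n /\ f = \prod_(i < n) 'X_i ^+ (n - i.+1)) \/
  (exists i j g, [/\ j = i.+1 :> nat, (w i < w j)%N,
     reach (swap_pos i j w) g & f = divdiff i j g]).
Proof. by case=> [|i j v g *]; [left|right; exists i, j, g]. Qed.

Lemma swap_pos_braid i j k w : i != j -> i != k -> j != k ->
  swap_pos i j (swap_pos j k (swap_pos i j w)) =
  swap_pos j k (swap_pos i j (swap_pos j k w)).
Proof.
move=> ij ik jk; have e := tperm_braid ij ik jk.
apply/permP => x; rewrite !swap_posE.
by have /permP/(_ x) := e; rewrite !permM => ->.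
Qed.

Lemma swap_pos_commute i j k l w :
  i != j -> k != l -> i != k -> i != l -> j != k -> j != l ->
  swap_pos i j (swap_pos k l w) = swap_pos k l (swap_pos i j w).
Proof.
move=> ij kl ik il jk jl; have e := tperm_commute ij kl ik il jk jl.
apply/permP => x; rewrite !swap_posE.
by have /permP/(_ x) := e; rewrite !permM => ->.
Qed.

Lemma reach_uniq w f f' : reach w f -> reach w f' -> f = f'.
Proof.
have [m] := ubnP (n * n - len w)%N; elim: m w f f' => // m IHm w f f' lt.
have IH i j g g' : j = i.+1 :> nat -> (w i < w j)%N ->
    reach (swap_pos i j w) g -> reach (swap_pos i j w) g' -> g = g'.
  move=> ij wij; apply: IHm.
  by have := len_swap_asc ij wij; have := len_max (swap_pos i j w); lia.
have diamond i j k l g g' : (i < k)%N ->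
    j = i.+1 :> nat -> (w i < w j)%N -> reach (swap_pos i j w) g ->
    l = k.+1 :> nat -> (w k < w l)%N -> reach (swap_pos k l w) g' ->
    divdiff i j g = divdiff k l g'.
  move=> ik ij wij rg kl wkl rg'; have [jk|jk] := eqVneq j k.
    subst k; have nij := adj_neq ij; have njl := adj_neq kl.
    have nil : i != l by rewrite -val_eqE /=; lia.
    have njni : j != i by rewrite eq_sym.
    have nlj : l != j by rewrite eq_sym.
    have nli : l != i by rewrite eq_sym.
    have [h rh] := reach_total (swap_pos i j (swap_pos j l (swap_pos i j w))).
    have rh' := rh; rewrite (swap_pos_braid _ nij nil njl) in rh'.
    have -> : g = divdiff j l (divdiff i j h).
      apply: (IH i j) => //; apply: reach_asc => //.
        by rewrite !swap_posE tpermR tpermD //; lia.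
      apply: reach_asc rh => //.
      by rewrite !swap_posE tpermL (tpermD njni nli) (tpermD nil njl) tpermL.
    have -> : g' = divdiff i j (divdiff j l h).
      apply: (IH j l) => //; apply: reach_asc => //.
        by rewrite !swap_posE tpermL tpermD //; lia.
      apply: reach_asc rh' => //;
      by rewrite !swap_posE tpermR (tpermD njni nli) (tpermD nil njl) tpermR.
    exact: divdiff_braid.
  have nij := adj_neq ij; have nkl := adj_neq kl.
  have nik : i != k by rewrite -val_eqE /=; lia.
  have nil : i != l by rewrite -val_eqE /=; lia.
  have njl : j != l.
    by move: jk; rewrite -!val_eqE /= ij kl; lia.
  have [h rh] := reach_total (swap_pos k l (swap_pos i j w)).
  have rh' := rh.
  rewrite -(swap_pos_commute _ nij nkl) // in rh'.
  have -> : g = divdiff k l h.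
    apply: (IH i j) => //; apply: reach_asc rh => //.
    by rewrite !swap_posE !tpermD.
  have -> : g' = divdiff i j h.
    apply: (IH k l) => //; apply: reach_asc rh' => //.
    by rewrite !swap_posE !tpermD // eq_sym.
  exact: divdiff_commute.
move=> /reach_inv[[wE ->]|[i [j [g [ij wij rg ->]]]]]
       /reach_inv[[wE' ->]|[k [l [g' [kl wkl rg' ->]]]]].
- by [].
- by have := w0_desc kl; move: wkl; rewrite wE; lia.
- by have := w0_desc ij; move: wij; rewrite wE'; lia.
case: (ltngtP i k) => [ik|ki|ik].
- exact: diamond.
- by apply/esym; exact: diamond.
have ek : i = k by exact: val_inj.
subst k; have el : j = l by apply: val_inj; rewrite /= ij kl.
by subst l; congr divdiff; apply: IH rg rg'.
Qed.

Lemma schubert_family_exists :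
  exists S : {ffun 'S_n -> {mpoly int[n]}}, is_schubert_family S.
Proof.
have [S SP] := fin_all_exists reach_total.
exists [ffun w => S w]; apply/andP; split.
  by rewrite ffunE; apply/eqP/(reach_uniq (SP _))/reach_w0.
apply/forallP => w; apply/forallP => i; apply/forallP => j.
apply/implyP => /eqP ij; apply/eqP; rewrite !ffunE len_swap //.
have asc v : (v i < v j)%N -> S v = divdiff i j (S (swap_pos i j v)).
  by move=> vij; apply: (reach_uniq (SP v)); apply: reach_asc.
have [wji|wij] := ltnP (w j) (w i).
  by rewrite [RHS]asc ?swap_posK // !swap_posE tpermL tpermR.
rewrite asc ?divdiff_id ?adj_neq // ltn_neqAle wij andbT.
by apply: contra (adj_neq ij) => /eqP/val_inj/perm_inj ->.
Qed.

Lemma schubert_family_uniq (S S' : {ffun 'S_n -> {mpoly int[n]}}) :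
  is_schubert_family S -> is_schubert_family S' -> S = S'.
Proof.
have fam (U : {ffun 'S_n -> {mpoly int[n]}}) w f :
    is_schubert_family U -> reach w f -> U w = f.
  move=> /andP[/eqP U0 /forallP UP]; elim=> // i j v g ij vij _ <-.
  have /forallP/(_ i)/forallP/(_ j) := UP (swap_pos i j v).
  rewrite ij eqxx len_swap // swap_posK !swap_posE tpermL tpermR vij /=.
  by move/eqP.
move=> SP SP'; apply/ffunP => w; have [f rf] := reach_total w.
by rewrite (fam _ _ _ SP rf) (fam _ _ _ SP' rf).
Qed.

End SchubertExists.

Definition schubert n (w : 'S_n) : {mpoly int[n]} :=
  xchoose (schubert_family_exists n) w.

Lemma schubertP n : is_schubert_family (xchoose (schubert_family_exists n)).
Proof. exact: xchooseP. Qed.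

(* Applied below to hooks of boxes i < j only, which have the odd size
   2 * (j - i) - 1, so the median is the middle entry of the sorted sequence. *)
Definition median (s : seq nat) : nat := nth 0%N (sort leq s) (size s)./2.

Section Tableaux.
Variable n : nat.
Implicit Types (w : 'S_n) (i j : 'I_n).

(* Fillings of the whole n x n square by {0, ..., n}; for a tableau of shape w
   the entries outside the shaded boxes, in particular those outside the
   staircase, are required to be 0. *)
Definition filling := 'M['I_n.+1]_n.
Implicit Types T : filling.

Definition has_shape w T : bool :=
  [forall i : 'I_n, forall j : 'I_n,
    if inversion w i j then (0 < T i j)%N else T i j == 0%N :> nat].

Definition hook T i j : seq nat :=
  (T i j : nat) :: [seq (T i' j : nat) | i' <- enum 'I_n & (i < i' < j)%N]
                ++ [seq (T i j' : nat) | j' <- enum 'I_n & (i < j' < j)%N].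

Definition weakly_balanced T : bool :=
  [forall i : 'I_n, forall j : 'I_n, (i < j)%N ==> (T i j == median (hook T i j) :> nat)].

Definition column_distinct w T : bool :=
  [forall i : 'I_n, forall i' : 'I_n, forall j : 'I_n,
    [&& inversion w i j, inversion w i' j & i != i'] ==> (T i j != T i' j)].

(* The row with 0-based index i is row i.+1 of the staircase. *)
Definition flagged T : bool :=
  [forall i : 'I_n, forall j : 'I_n, (j == i.+1 :> nat) ==> (T i j <= i.+1)%N].

Definition IT w : {set filling} :=
  [set T | [&& has_shape w T, weakly_balanced T, column_distinct w T
             & flagged T]].

Definition wt T (k : nat) : nat :=
  #|[set p : 'I_n * 'I_n | T p.1 p.2 == k :> nat]|.

(* x_1^{m_1} ... x_{n-1}^{m_{n-1}} with m_k = wt T k: entries equal to 0 or n do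
   not contribute. *)
Definition xwt T : {mpoly int[n]} :=
  \prod_(i < n | (i.+1 < n)%N) 'X_i ^+ wt T i.+1.

End Tableaux.

(* Main.v *)
Require Import Defs.
From mathcomp Require Import all_boot all_order all_fingroup all_algebra.
From mathcomp Require Import mpoly zify ring.

(** Both sides count chains in the weak order.

    On the side of tableaux, a filling is weakly balanced exactly when [T i k]
    lies between [T i j] and [T j k] for all [i < j < k]
    ([weakly_balanced_between]).  So each set of boxes with entries at least [k]
    is biconvex, hence the inversion set of a permutation [w_k]
    ([biconvex_perm]), and a tableau of shape [w] is a chain
    [Inv w = Inv w_1], [Inv w_2], [Inv w_3], ... decreasing to the empty set.
    Since entries are distinct in columns, one step of the chain removes at most
    one box from each column.  By the flag condition, [w_k] has no descent in
    its first [k - 1] positions.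

    On the side of Schubert polynomials, following Fomin and Stanley, let [u_a]
    be the generators of the nilCoxeter algebra and consider the product over
    [k = 1, ..., n - 1] of the factors [(1 + x_k u_(n-1)) ... (1 + x_k u_k)].  The
    Yang-Baxter relation makes decreasing products with the same letters commute
    ([dec_prod_comm]).  It follows that the divided difference in [x_i] and
    [x_(i+1)] multiplies the whole product by [u_i] on the right
    ([nilschub_divided_difference]).  This is the recursion of Schubert
    polynomials, so they are the coefficients of the product
    ([schubert_nilschub]).

    The two sides meet when the factors are removed from the left.  Removing a
    letter [a] from the left of a permutation exchanges two adjacent values,
    which removes one box from the inversions diagram and leaves the others in
    place.  A whole factor removes a set of boxes with at most one box in each
    column, and every such way to go down in the weak order comes from exactly
    one set of letters ([dec_prod_sum]).  That the [k]-th factor has no letter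
    below [k] means that the values below [k] do not move; along a chain that
    ends at the identity this is equivalent to the flag condition
    ([flagged_peelsE]).  Hence both sides satisfy the same recursion
    ([sum_IT_above]). *)

Set Implicit Arguments.
Unset Strict Implicit.
Unset Printing Implicit Defensive.

Import GRing.Theory.
Local Open Scope ring_scope.

(** * Decreasing products in the nilCoxeter algebra *)

Section NilCoxeter.
Variables (m : nat) (R : comNzRingType).
Implicit Types (w v : 'S_m.+1) (i j : 'I_m.+1) (a b c k : nat) (x y z : R).
Implicit Types f g : {ffun 'S_m.+1 -> R}.

(** The exchange of the adjacent values [a] and [a.+1], to be multiplied on the
    right of a permutation.  Letters are natural numbers, meaningful below [m],
    so that inductions on letters need no ordinals. *)
Definition adj_swap a : 'S_m.+1 := tperm (inord a) (inord a.+1).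

Definition value_desc a w : bool := (w^-1%g (inord a.+1) < w^-1%g (inord a))%N.

(** Left multiplication by the generator [u_a] of the nilCoxeter algebra, an
    element [sum_w (f w) w] of the algebra being encoded by its coefficient
    function [f]: since [u_a u_v] is [u_(s_a v)] when this is longer and 0
    otherwise, the coefficient of [w] in the product is that of [s_a w] when
    [s_a w] is shorter than [w], that is, when [a.+1] stands to the left of
    [a] in [w]. *)
Definition nilop a f : {ffun 'S_m.+1 -> R} :=
  [ffun w => if value_desc a w then f (w * adj_swap a)%g else 0].

Definition axpy f x g : {ffun 'S_m.+1 -> R} := [ffun w => f w + x * g w].

(** Multiplication by [1 + x u_a], the exponential of [x u_a] because
    [u_a] squares to zero. *)
Definition exp_op a x f := axpy f x (nilop a f).

Lemma inord_neq a b : (a <= m)%N -> (b <= m)%N -> a != b ->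
  inord a != inord b :> 'I_m.+1.
Proof. by move=> am bm; rewrite -val_eqE /= !inordK. Qed.

Lemma adj_swap_inord a c : (a < m)%N -> (c <= m)%N ->
  adj_swap a (inord c) = inord (if c == a then a.+1 else if c == a.+1 then a
    else c).
Proof.
move=> am cm; rewrite /adj_swap.
case: eqP => [->|/eqP ca]; first by rewrite tpermL.
case: eqP => [->|/eqP ca1]; first by rewrite tpermR.
by rewrite tpermD // inord_neq 1?eq_sym //; lia.
Qed.

Lemma val_adj_swap a (i : 'I_m.+1) : (a < m)%N ->
  adj_swap a i = (if i == a :> nat then a.+1 else if i == a.+1 :> nat then a
    else i)
    :> nat.
Proof.
move=> am; rewrite -{1}(inord_val i) adj_swap_inord // ?inordK //;
  last exact: ltn_ord i.
by case: eqP => _; last case: eqP => _; have := ltn_ord i; lia.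
Qed.

Lemma mul_adj_swapV a w i : ((w * adj_swap a)^-1 i = w^-1 (adj_swap a i))%g.
Proof. by rewrite invMg permM tpermV. Qed.

Lemma value_desc_adj_swap b a w : value_desc b (w * adj_swap a)%g =
  (w^-1%g (adj_swap a (inord b.+1)) < w^-1%g (adj_swap a (inord b)))%N.
Proof. by rewrite /value_desc !mul_adj_swapV. Qed.

Lemma nilop_sq a f : (a < m)%N -> nilop a (nilop a f) = [ffun _ => 0].
Proof.
move=> am; apply/ffunP => w;
  rewrite !ffunE value_desc_adj_swap /value_desc !adj_swap_inord //; try lia.
rewrite !eqxx; case: ifP => // lt; case: ifP => //.
by case: eqP => [|_]; lia.
Qed.

Lemma nilop_comm a b f : (a.+1 < b)%N -> (b < m)%N ->
  nilop a (nilop b f) = nilop b (nilop a f).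
Proof.
move=> ab bm; apply/ffunP => w;
  rewrite !ffunE !value_desc_adj_swap /value_desc !adj_swap_inord //; try lia.
have -> : (a == b) = false by lia.
have -> : (a == b.+1) = false by lia.
have -> : (b == a) = false by lia.
have -> : (b == a.+1) = false by lia.
have -> : (a.+1 == b) = false by lia.
have -> : (a.+1 == b.+1) = false by lia.
have -> : (b.+1 == a) = false by lia.
have -> : (b.+1 == a.+1) = false by lia.
rewrite -!mulgA /adj_swap tperm_commute; try by rewrite inord_neq //; lia.
by case: ifP; case: ifP.
Qed.

(** Both sides vanish at [w] unless [a.+2], [a.+1], [a] occur in this order from
    left to right in [w]; then both reverse these three values. *)
Lemma nilop_braid a f : (a.+1 < m)%N ->
  nilop a (nilop a.+1 (nilop a f)) = nilop a.+1 (nilop a (nilop a.+1 f)).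
Proof.
move=> am; apply/ffunP => w;
  rewrite !ffunE !value_desc_adj_swap /value_desc !mul_adj_swapV.
have aL : adj_swap a (inord a) = inord a.+1 by rewrite /adj_swap tpermL.
have aR : adj_swap a (inord a.+1) = inord a by rewrite /adj_swap tpermR.
have aD : adj_swap a (inord a.+2) = inord a.+2.
  by rewrite /adj_swap tpermD // inord_neq //; lia.
have bL : adj_swap a.+1 (inord a.+1) = inord a.+2 by rewrite /adj_swap tpermL.
have bR : adj_swap a.+1 (inord a.+2) = inord a.+1 by rewrite /adj_swap tpermR.
have bD : adj_swap a.+1 (inord a) = inord a.
  by rewrite /adj_swap tpermD // inord_neq //; lia.
rewrite !(aL, aR, aD, bL, bR, bD).
rewrite -!mulgA !(mulgA (adj_swap _)) tperm_braid;
  try by rewrite inord_neq //; lia.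
move: ((w^-1)%g (inord a)) ((w^-1)%g (inord a.+1)) ((w^-1)%g (inord a.+2)) =>
  p q r.
case: (ltnP q p) => ?; case: (ltnP r q) => ?; case: (ltnP r p) => ? //; lia.
Qed.

Lemma nilop_axpy a f x g : nilop a (axpy f x g) =
  axpy (nilop a f) x (nilop a g).
Proof. by apply/ffunP => w; rewrite !ffunE; case: ifP;
  rewrite ?mulr0 ?addr0. Qed.

Lemma exp_op_axpy a y f x g : exp_op a y (axpy f x g) =
  axpy (exp_op a y f) x (exp_op a y g).
Proof. by rewrite /exp_op nilop_axpy; apply/ffunP => w; rewrite !ffunE;
  ring. Qed.

Lemma exp_op0 a f : exp_op a 0 f = f.
Proof. by apply/ffunP => w; rewrite !ffunE mul0r addr0. Qed.

Lemma exp_opD a x y f : (a < m)%N ->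
  exp_op a x (exp_op a y f) = exp_op a (x + y) f.
Proof.
move=> am; rewrite /exp_op nilop_axpy nilop_sq //; apply/ffunP => w;
  rewrite !ffunE; ring.
Qed.

(** Expanding with [u_a u_a = 0], the two sides differ only in the cubic term,
    where the braid relation applies. *)
Lemma yang_baxter a x y f : (a.+1 < m)%N ->
  exp_op a x (exp_op a.+1 (x + y) (exp_op a y f)) =
    exp_op a.+1 y (exp_op a (x + y) (exp_op a.+1 x f)).
Proof.
move=> am; have am' : (a < m)%N by lia.
have U0 b : nilop b [ffun _ => 0] = [ffun _ => 0].
  by apply/ffunP => w; rewrite !ffunE if_same.
rewrite /exp_op !nilop_axpy !nilop_sq // nilop_braid // ?U0.
move: (nilop a f) (nilop a.+1 f) (nilop a (nilop a.+1 f)) (nilop a.+1 (nilop a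
  f)) (nilop a.+1 (nilop a _)).
move=> f1 f2 f3 f4 f5.
by apply/ffunP => w; rewrite !ffunE; ring.
Qed.

(** The product [(1 + x u_(m-1)) ... (1 + x u_k)], with decreasing letters. *)
Definition dec_prod k x f := foldl (fun g a => exp_op a x g) f (iota k (m - k)).

Lemma dec_prod_rec k x f : (k < m)%N ->
  dec_prod k x f = dec_prod k.+1 x (exp_op k x f).
Proof. by rewrite /dec_prod => km;
  have -> : (m - k = (m - k.+1).+1)%N by lia. Qed.

Lemma dec_prod_id k x f : (m <= k)%N -> dec_prod k x f = f.
Proof. by rewrite /dec_prod => km; have -> : (m - k = 0)%N by lia. Qed.

Lemma down_ind (P : nat -> Prop) : (forall k, (m <= k)%N -> P k) ->
  (forall k, (k < m)%N -> P k.+1 -> P k) -> forall k, P k.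
Proof.
move=> P0 PS k; have [d] := ubnP (m - k); elim: d k => // d IH k lt.
by case: (leqP m k) => km; [exact: P0 | apply: PS => //; apply: IH; lia].
Qed.

Lemma dec_prod_axpy k y f x g : dec_prod k y (axpy f x g) =
  axpy (dec_prod k y f) x (dec_prod k y g).
Proof.
elim/down_ind: k f g => [k km|k km IH] f g;
  first by rewrite !(dec_prod_id _ _ km).
by rewrite !(dec_prod_rec _ _ km) exp_op_axpy IH.
Qed.

Lemma nilop_dec_prod a k y f : (a.+1 < k)%N ->
  nilop a (dec_prod k y f) = dec_prod k y (nilop a f).
Proof.
elim/down_ind: k f => [k km|k km IH] f ak;
  first by rewrite !(dec_prod_id _ _ km).
rewrite !(dec_prod_rec _ _ km) IH; last by lia.
by rewrite /exp_op nilop_axpy nilop_comm.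
Qed.

Lemma exp_op_dec_prod a k x y f : (a.+1 < k)%N ->
  exp_op a x (dec_prod k y f) = dec_prod k y (exp_op a x f).
Proof. by move=> ak; rewrite /exp_op nilop_dec_prod // -dec_prod_axpy. Qed.

(** Downward induction on [k].  Up to the factors with letters beyond [k.+1],
    the claim concerns the letters [k] and [k.+1] only; there the Yang-Baxter
    relation, used with the parameters [x] and [y - x], moves the factor
    [1 + y u_(k+1)] to the front, and the induction hypothesis exchanges [x]
    and [y] in the products from [k.+1] on. *)
Lemma dec_prod_comm k x y f : dec_prod k x (dec_prod k y f) =
  dec_prod k y (dec_prod k x f).
Proof.
elim/down_ind: k f => [k km|k km IH] f; first by rewrite !(dec_prod_id _ _ km).
case: (ltnP k.+1 m) => [km1|km1]; last first.
  by rewrite !(dec_prod_rec _ _ km) !(dec_prod_id (k := k.+1)) //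
    !exp_opD // addrC.
have E z u g : dec_prod k z (dec_prod k u g) =
  dec_prod k.+1 z (dec_prod k.+2 u (exp_op k z (exp_op k.+1 u (exp_op k u g)))).
  by rewrite !(dec_prod_rec _ _ km) (dec_prod_rec u _ km1) exp_op_dec_prod.
have YB : exp_op k x (exp_op k.+1 y (exp_op k y f)) =
          exp_op k.+1 y (exp_op k.+1 (- x) (exp_op k y (exp_op k.+1 x (exp_op
            k x f)))).
  have := yang_baxter x (y - x) (exp_op k x f) km1.
  by rewrite (exp_opD (a := k)) // exp_opD // subrK addrCA subrr addr0.
by rewrite !E YB -(dec_prod_rec y _ km1) IH (dec_prod_rec x _ km1) exp_opD //
  subrr exp_op0.
Qed.

(** With [P x y] the product on the left, [P x y (1 + y u_k)] is the product of
    two commuting factors, hence symmetric in [x] and [y].  Multiplying on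
    the right by [1 - y u_k] gives [P x y = P y x (1 + (x - y) u_k)], and [P y x u_k] equals
    [P x y u_k]. *)
Lemma dec_prod_pair k x y f : (k < m)%N ->
  dec_prod k x (dec_prod k.+1 y f) =
  axpy (dec_prod k y (dec_prod k.+1 x f)) (x - y) (dec_prod k x (dec_prod k.+1
    y (nilop k f))).
Proof.
move=> km.
have E g : dec_prod k x (dec_prod k.+1 y g) =
  dec_prod k y (dec_prod k.+1 x (exp_op k (x - y) g)).
  have eg : g = exp_op k y (exp_op k (- y) g) by rewrite exp_opD //
    subrr exp_op0.
  by rewrite {1}eg -(dec_prod_rec y _ km) dec_prod_comm (dec_prod_rec x _ km)
    exp_opD.
have -> : dec_prod k x (dec_prod k.+1 y (nilop k f)) =
  dec_prod k y (dec_prod k.+1 x (nilop k f)).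
  rewrite E; congr (dec_prod k y (dec_prod k.+1 x _)).
  by rewrite /exp_op nilop_sq //; apply/ffunP => w; rewrite !ffunE mulr0 addr0.
by rewrite E -!dec_prod_axpy.
Qed.

Definition delta1 : {ffun 'S_m.+1 -> R} := [ffun w => (w == 1%g)%:R].

(** The product of the factors with parameters [X k], ..., [X m.-1], the factor
    of parameter [X a] using the letters from [a] on.  For [k = 0] its
    coefficients turn out to be the Schubert polynomials. *)
Definition nilschub (X : nat -> R) k :=
  foldr (fun a g => dec_prod a (X a) g) delta1 (iota k (m - k)).

Lemma nilschub_delta X k : (m <= k)%N -> nilschub X k = delta1.
Proof. by rewrite /nilschub => km; have -> : (m - k = 0)%N by lia. Qed.

Lemma nilschub_rec X k : nilschub X k = dec_prod k (X k) (nilschub X k.+1).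
Proof.
case: (ltnP k m) => km; last by rewrite (dec_prod_id _ _ km) !nilschub_delta
  //; lia.
by rewrite /nilschub; have -> : (m - k = (m - k.+1).+1)%N by lia.
Qed.

(** Right multiplication by a generator: it exchanges positions instead of
    values, as divided differences do. *)
Definition right_op (i j : 'I_m.+1) f : {ffun 'S_m.+1 -> R} :=
  [ffun w : 'S_m.+1 => if (w j < w i)%N then f (swap_pos i j w) else 0].

Lemma ltn_adj_swap a (x y : 'I_m.+1) : (a < m)%N ->
    ~~ ((x == a :> nat) && (y == a.+1 :> nat)) ->
    ~~ ((x == a.+1 :> nat) && (y == a :> nat)) ->
  (adj_swap a x < adj_swap a y)%N = (x < y)%N.
Proof.
move=> am; rewrite !val_adj_swap //; move: (x : nat) (y : nat) => {}x {}y.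
by case: (eqVneq x a); case: (eqVneq y a); case: (eqVneq x a.+1);
  case: (eqVneq y a.+1); lia.
Qed.

Lemma adj_swapE (i j : 'I_m.+1) : j = i.+1 :> nat -> adj_swap i = tperm i j.
Proof. by move=> ij; rewrite /adj_swap -ij !inord_val. Qed.

(** Left and right multiplication commute.  Exchanging two adjacent values only
    affects the comparison of the entries in positions [i] and [j] when these
    entries are the two values; in this case both sides vanish. *)
Lemma right_op_nilop i j a f : j = i.+1 :> nat -> (a < m)%N ->
  right_op i j (nilop a f) = nilop a (right_op i j f).
Proof.
move=> ij am; apply/ffunP => w; rewrite !ffunE /swap_pos -!mulgA.
rewrite /value_desc invMg !permM tpermV -(adj_swapE ij).
set p := (w^-1)%g (inord a); set q := (w^-1)%g (inord a.+1).
have wp : w p = a :> nat by rewrite permKV inordK //; lia.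
have wq : w q = a.+1 :> nat by rewrite permKV inordK //; lia.
have wpE (x : 'I_m.+1) : (w x == a :> nat) = (x == p).
  by rewrite -wp val_eqE (inj_eq perm_inj).
have wqE (x : 'I_m.+1) : (w x == a.+1 :> nat) = (x == q).
  by rewrite -wq val_eqE (inj_eq perm_inj).
have im : (i < m)%N by have := ltn_ord j; lia.
case: (boolP ((i == p) && (j == q))) => [/andP[/eqP ip /eqP jq]|npq].
  by rewrite !ip !jq wp wq ltnNge leqnSn /= -{1}ip -jq ij ltnNge leqnSn.
case: (boolP ((j == p) && (i == q))) => [/andP[/eqP jp /eqP iq]|nqp].
  have qm : (q < m)%N by rewrite -iq.
  have pq : p = q.+1 :> nat by rewrite -jp -iq.
  rewrite jp iq wp wq ltnS leqnn !val_adj_swap // wp wq pq !eqxx.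
  by rewrite !gtn_eqF // !(ltnNge _.+1) !leqnSn ?if_same.
rewrite (ltn_adj_swap (a := a)) ?wpE ?wqE //; try by rewrite andbC.
rewrite (ltn_adj_swap (a := i)) //
  ?(eq_sym _ (i : nat)) -?ij ?(eq_sym _ (j : nat)) ?val_eqE //.
  by case: ifP; case: ifP.
all: by rewrite andbC.
Qed.

Lemma right_op_axpy i j f x g : right_op i j (axpy f x g) =
  axpy (right_op i j f) x (right_op i j g).
Proof. by apply/ffunP => w; rewrite !ffunE; case: ifP;
  rewrite ?mulr0 ?addr0. Qed.

Lemma right_op_dec_prod i j k x f : j = i.+1 :> nat ->
  right_op i j (dec_prod k x f) = dec_prod k x (right_op i j f).
Proof.
move=> ij; elim/down_ind: k f => [k km|k km IH] f;
  first by rewrite !(dec_prod_id _ _ km).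
by rewrite !(dec_prod_rec _ _ km) IH /exp_op right_op_axpy right_op_nilop.
Qed.

Lemma right_op_delta i j : j = i.+1 :> nat ->
  right_op i j delta1 = nilop i delta1.
Proof.
move=> ij; apply/ffunP => w; rewrite !ffunE /swap_pos /value_desc /adj_swap.
have -> : inord i = i by rewrite inord_val.
have -> : inord i.+1 = j by rewrite -ij inord_val.
have -> : (w * tperm i j == 1)%g = (w == tperm i j).
  by rewrite -[RHS](inj_eq (mulIg (tperm i j))) tperm2.
have -> : (tperm i j * w == 1)%g = (w == tperm i j).
  by rewrite -(inj_eq (mulgI (tperm i j))) mulgA tperm2 mul1g mulg1.
case: (eqVneq w (tperm i j)) => [->|]; last by rewrite !if_same.
by rewrite tpermV !tpermL !tpermR.
Qed.

(** The letter [i] commutes with every letter beyond [i.+1], so it can be moved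
    to the right end of the product. *)
Lemma right_op_nilschub i j X k : j = i.+1 :> nat -> (i.+1 < k)%N ->
  right_op i j (nilschub X k) = nilop i (nilschub X k).
Proof.
move=> ij; elim/down_ind: k => [k km|k km IH] ik.
  by rewrite !(nilschub_delta _ km) right_op_delta.
by rewrite !(nilschub_rec X k) right_op_dec_prod // nilop_dec_prod // IH //;
  lia.
Qed.

End NilCoxeter.

(** * Divided differences of the product *)

Section ChangeOfVariables.
Variables (m : nat) (R : comNzRingType) (s : {rmorphism R -> R}).
Implicit Types (i j : 'I_m.+1) (a k : nat) (x : R).
Implicit Types f g : {ffun 'S_m.+1 -> R}.

Definition map_coef f : {ffun 'S_m.+1 -> R} := [ffun w => s (f w)].

Lemma map_coef_dec_prod k x f : map_coef (dec_prod k x f) =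
  dec_prod k (s x) (map_coef f).
Proof.
elim/(@down_ind m): k f => [k km|k km IH] f;
  first by rewrite !(dec_prod_id _ _ km).
rewrite !(dec_prod_rec _ _ km) IH; congr dec_prod; apply/ffunP => w;
  rewrite !ffunE.
by rewrite rmorphD rmorphM; case: ifP; rewrite ?rmorph0.
Qed.

Lemma map_coef_nilschub (X : nat -> R) k :
  (forall a, (k <= a < m)%N -> s (X a) = X a) ->
    map_coef (nilschub m X k) = nilschub m X k.
Proof.
elim/(@down_ind m): k => [k km|k km IH] sX.
  by rewrite !(nilschub_delta _ km); apply/ffunP => w;
    rewrite !ffunE rmorph_nat.
by rewrite nilschub_rec map_coef_dec_prod IH ?sX ?leqnn // => a ka;
  apply: sX; lia.
Qed.

(** The divided difference in [X i] and [X j] acts on the product as right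
    multiplication by the generator [u_i].  Only the two factors with these
    parameters change under [s]; the factors after them commute with [u_i], and
    the factors before them are linear with coefficients fixed by [s]. *)
Lemma nilschub_divided_difference (X : nat -> R) i j k : j = i.+1 :> nat ->
  s (X i) = X j -> s (X j) = X i ->
  (forall a, (a < m)%N -> a != i -> a != j -> s (X a) = X a) -> (k <= i)%N ->
  nilschub m X k = axpy (map_coef (nilschub m X k)) (X i - X j) (right_op i j
    (nilschub m X k)).
Proof.
move=> ij si sj sX ki; rewrite -(subKn ki).
have im : (i < m)%N by have := ltn_ord j; lia.
elim: (i - k)%N => [|d IH].
  have sG : map_coef (nilschub m X i.+2) = nilschub m X i.+2.
    by apply: map_coef_nilschub => a ai; apply: sX; lia.
  rewrite subn0 (nilschub_rec _ X i) (nilschub_rec _ X i.+1)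
    !map_coef_dec_prod !right_op_dec_prod // sG -ij si sj.
  rewrite right_op_nilschub ?ij //; exact: dec_prod_pair.
case: (leqP i d) => id.
  by move: IH; have -> : (i - d.+1 = i - d)%N by lia.
rewrite (nilschub_rec _ X (i - d.+1)).
have -> : (i - d.+1).+1 = (i - d)%N by lia.
rewrite map_coef_dec_prod right_op_dec_prod // sX; try lia.
by rewrite [in LHS]IH dec_prod_axpy.
Qed.

End ChangeOfVariables.

(** * Inversion sets and biconvexity *)

Section InversionSets.
Variable n : nat.
Implicit Types (u v w : 'S_n) (i j k : 'I_n).

Lemma card_ord_lt c : (c <= n)%N -> #|[set i : 'I_n | (i < c)%N]| = c.
Proof.
move=> cn; have wI : injective (widen_ord cn) by move=> i j [] /val_inj.
rewrite -[RHS]card_ord -[RHS](card_imset _ wI).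
apply: eq_card => i; rewrite inE; apply/idP/imsetP => [ic|[j _ ->]].
  by exists (Ordinal ic) => //; apply: val_inj.
by rewrite /= ltn_ord.
Qed.

Lemma perm_rank w i : #|[set j | (w j < w i)%N]| = w i.
Proof.
rewrite -[RHS](card_ord_lt (ltnW (ltn_ord (w i)))).
rewrite -(card_imset _ (@perm_inj _ w)); apply: eq_card => x.
rewrite inE; apply/imsetP/idP => [[j + ->]|xi]; first by rewrite inE.
by exists (w^-1 x)%g; rewrite ?inE permKV.
Qed.

Lemma mem_Inv w i j : ((i, j) \in Inv w) = (i < j)%N && (w j < w i)%N.
Proof. by rewrite inE. Qed.

(** The relative order of all entries, hence the permutation, can be read off
    from the inversion set. *)
Lemma perm_ltn w i j : (w i < w j)%N =
  if (i < j)%N then (i, j) \notin Inv w else (j, i) \in Inv w.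
Proof.
rewrite !mem_Inv; case: (ltngtP i j) => [ij|ij|/val_inj ->] /=;
  rewrite ?ltnn //.
have : w i != w j by rewrite (inj_eq perm_inj) -val_eqE neq_ltn ij.
rewrite -val_eqE /=; lia.
Qed.

Lemma Inv_inj : injective (@Inv n).
Proof.
move=> v w e; apply/permP => i; apply: val_inj => /=.
rewrite -perm_rank -[RHS]perm_rank; apply: eq_card => j.
by rewrite !inE !perm_ltn e.
Qed.

Definition biconvex (B : {set 'I_n * 'I_n}) :=
  forall i j k, (i < j)%N -> (j < k)%N ->
    ((i, j) \in B -> (j, k) \in B -> (i, k) \in B) /\
    ((i, k) \in B -> (i, j) \in B \/ (j, k) \in B).

Lemma biconvex_Inv w : biconvex (Inv w).
Proof. by move=> i j k ij jk; rewrite !mem_Inv; split; lia. Qed.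

(** Inverting the natural order of the positions exactly on [B] gives a
    relation that is transitive because [B] is biconvex; the permutation sends a
    position to its rank for this total order. *)
Lemma biconvex_perm (B : {set 'I_n * 'I_n}) :
  (forall i j, (i, j) \in B -> (i < j)%N) -> biconvex B ->
  exists w, Inv w = B.
Proof.
move=> Blt Bc.
pose lt i j := if (i < j)%N then (i, j) \notin B else (j, i) \in B.
have Bn i j : (j <= i)%N -> (i, j) \in B = false.
  by move=> ji; apply/negP => /Blt; lia.
have lt_irr i : lt i i = false by rewrite /lt ltnn Bn.
have lt_tot i j : i != j -> lt j i = ~~ lt i j.
  rewrite /lt -val_eqE /= neq_ltn => /orP[ij|ji].
    by rewrite ij (leq_gtF (ltnW ij)) negbK.
  by rewrite ji (leq_gtF (ltnW ji)).
have lt_tr i j k : lt i j -> lt j k -> lt i k.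
  case: (eqVneq i j) => [->|nij] //; case: (eqVneq j k) => [->|njk] //.
  case: (eqVneq i k) => [->|nik].
    by move=> a; rewrite (lt_tot k j) ?a // eq_sym.
  move: nij njk nik; rewrite /lt -!val_eqE /= => nij njk nik.
  case: (ltngtP i j) nij => [ij|ji|//] _;
    case: (ltngtP j k) njk => [jk|kj|//] _;
  case: (ltngtP i k) nik => [ik|ki|//] _; try lia.
  - have [_ c] := Bc _ _ _ ij jk; move=> a b; apply/negP => /c[]; exact/negP.
  - have [c _] := Bc _ _ _ ik kj; move=> a b; apply: contra a => a; exact: c.
  - have [_ c] := Bc _ _ _ ki ij => a b; case: (c b) => //;
    by rewrite (negPf a).
  - have [c _] := Bc _ _ _ ji ik => a b; apply: contra b => b; exact: c.
  - have [_ c] := Bc _ _ _ jk ki => a b; case: (c a) => //;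
    by rewrite (negPf b).
  - by have [c _] := Bc _ _ _ kj ji => a b; exact: c.
pose r i := #|[set j | lt j i]|.
have r_lt i j : lt i j -> (r i < r j)%N.
  move=> ij; apply/proper_card/properP; split.
    by apply/subsetP => k; rewrite !inE => /lt_tr; apply.
  by exists i; rewrite inE ?lt_irr.
have rn i : (r i < n)%N.
  rewrite -[X in (_ < X)%N]card_ord; apply/proper_card/properP; split.
    exact/subsetP.
  by exists i; rewrite // inE lt_irr.
pose f i := Ordinal (rn i).
have fI : injective f.
  move=> i j [e]; apply/eqP/negPn/negP => nij.
  have := lt_tot _ _ nij; case: (boolP (lt i j)) => [/r_lt|_ /r_lt]; lia.
have rE i j : (r i < r j)%N = lt i j.
  case: (eqVneq i j) => [->|nij]; first by rewrite ltnn lt_irr.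
  have := lt_tot _ _ nij; case: (boolP (lt i j)) => [/r_lt //|_ /r_lt]; lia.
exists (perm fI); apply/setP => -[i j]; rewrite mem_Inv !permE /= rE /lt.
case: (ltngtP i j) => [//|ji|/val_inj ->] /=; rewrite Bn //; exact: ltnW.
Qed.

End InversionSets.

(** * Coefficients of decreasing products *)

Section Peeling.
Variable m : nat.
Implicit Types (u v w : 'S_m.+1) (i j : 'I_m.+1) (k : nat).
Implicit Types D : {set 'I_m.+1 * 'I_m.+1}.

Definition col_inj (D : {set 'I_m.+1 * 'I_m.+1}) : bool := dinjectiveb snd D.

Lemma col_injP D :
  reflect (forall i i' j, (i, j) \in D -> (i', j) \in D -> i = i') (col_inj D).
Proof.
apply: (iffP (dinjectiveP _ _)) => [inj i i' j Di Di'|inj [i j] [i' j'] /=].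
  by have [] := inj _ _ Di Di' erefl.
by move=> Di Di' e; move: Di'; rewrite -e => /(inj _ _ _ Di) ->.
Qed.

(** Describes the permutations [u] left when one decreasing product of letters
    at least [k] is removed from the left of [v]. *)
Definition peels k v u : bool :=
  [&& Inv u \subset Inv v, col_inj (Inv v :\: Inv u)
    & [forall i : 'I_m.+1, (v i < k)%N ==> (u i == v i)]].

Lemma peelsP k v u :
  reflect [/\ Inv u \subset Inv v, col_inj (Inv v :\: Inv u)
    & forall i, (v i < k)%N -> u i = v i] (peels k v u).
Proof.
apply: (iffP and3P) => -[? ? uv]; split=> //.
  by move=> i vik; apply/eqP; move/forallP/(_ i)/implyP: uv; apply.
by apply/forallP => i; apply/implyP => vik; rewrite uv.
Qed.

(** The hypothesis says that the values below [k] are at the same places in [u]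
    and in [v], which is symmetric. *)
Lemma agree_sym k u v : (forall i, (v i < k)%N -> u i = v i) ->
  forall i, (u i < k)%N -> u i = v i.
Proof.
move=> uv i uik; pose j := (v^-1 (u i))%g.
have vj : v j = u i by rewrite permKV.
have := uv j; rewrite vj => /(_ uik) /perm_inj e.
by rewrite -vj e.
Qed.

Lemma Inv_adj_swap k u : (k < m)%N -> value_desc k u ->
  Inv u = (u^-1%g (inord k.+1), u^-1%g (inord k)) |: Inv (u * adj_swap m k)%g /\
  (u^-1%g (inord k.+1), u^-1%g (inord k)) \notin Inv (u * adj_swap m k)%g.
Proof.
rewrite /value_desc; set p := (u^-1)%g (inord k);
  set q := (u^-1)%g (inord k.+1).
move=> km qp.
have up : u p = k :> nat by rewrite permKV inordK //; lia.
have uq : u q = k.+1 :> nat by rewrite permKV inordK //; lia.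
have upE i : (u i == k :> nat) = (i == p).
  by rewrite -up val_eqE (inj_eq perm_inj).
have uqE i : (u i == k.+1 :> nat) = (i == q).
  by rewrite -uq val_eqE (inj_eq perm_inj).
split; last first.
  rewrite mem_Inv !permM !val_adj_swap // up uq !eqxx qp (gtn_eqF (ltnSn k)) /=.
  by rewrite ltnNge leqnSn.
apply/setP => -[i j]; rewrite in_setU1 !mem_Inv xpair_eqE !permM.
case: (ltnP i j) => [ij|ji] /=; last first.
  by apply/esym/negP; rewrite orbF => /andP[/eqP ei /eqP ej]; move: ji qp;
    rewrite ei ej; lia.
case: (boolP ((i == q) && (j == p))) => [/andP[/eqP -> /eqP ->]|nij] /=.
  by rewrite up uq ltnS leqnn.
rewrite ltn_adj_swap // ?upE ?uqE 1?andbC //.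
by apply/negP => /andP[/eqP ei /eqP ej]; move: ij qp; rewrite ei ej; lia.
Qed.

Lemma adj_swapK k u : (u * adj_swap m k * adj_swap m k)%g = u.
Proof. by rewrite -mulgA tperm2 mulg1. Qed.

Lemma peels_card k v u : (k < m)%N -> value_desc k u -> Inv u \subset Inv v ->
  #|Inv v :\: Inv (u * adj_swap m k)%g| = #|Inv v :\: Inv u|.+1.
Proof.
move=> km /(Inv_adj_swap km)[e ni] uv.
have qv := subsetP uv; rewrite e in qv *.
set x := (_, _) in ni qv *.
rewrite [LHS](cardsD1 x) inE ni (qv x) ?setU11 //= add1n; congr _.+1.
by apply: eq_card => y; rewrite !inE negb_or andbA.
Qed.

(** Exchanging [k] and [k.+1] removes a box in the column of the position [p]
    of [k].  No box of this column has been removed from [v] to [u]: in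
    both, its rows are those before [p] that hold values beyond [k], because
    the values up to [k] have not moved. *)
Lemma peels_exchange k v u : (k < m)%N -> peels k.+1 v u -> value_desc k u ->
  peels k v (u * adj_swap m k)%g && ~~ peels k.+1 v (u * adj_swap m k)%g.
Proof.
move=> km /peelsP[uv cu vu] du; have [e ni] := Inv_adj_swap km du.
move: e ni du; rewrite /value_desc.
set p := (u^-1)%g (inord k); set q := (u^-1)%g (inord k.+1) => e ni qp.
have up : u p = k :> nat by rewrite permKV inordK //; lia.
have uq : u q = k.+1 :> nat by rewrite permKV inordK //; lia.
have vp : v p = k :> nat by rewrite -(agree_sym vu) ?up.
have pcol r : (r, p) \in Inv v -> (r, p) \in Inv u.
  rewrite !mem_Inv up vp => /andP[-> kv] /=; rewrite ltnNge; apply/negP => ur.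
  by have := agree_sym vu (i := r); rewrite ltnS ur => /(_ isT) ur';
    move: kv; rewrite -ur'; lia.
apply/andP; split; last first.
  apply/negP => /peelsP[_ _ /(_ p)]; rewrite vp ltnS leqnn => /(_ isT).
  by move=> /(congr1 val) /=; rewrite permM val_adj_swap // up eqxx vp; lia.
apply/peelsP; split.
- by apply: subset_trans uv; rewrite e subsetUr.
- have col i j : (i, j) \in Inv v :\: Inv (u * adj_swap m k)%g ->
     (i, j) = (q, p) \/ j != p /\ (i, j) \in Inv v :\: Inv u.
    rewrite !in_setD e in_setU1; case: (eqVneq (i, j) (q, p)); first by left.
    move=> nij /andP[nu iv]; right; split; last by rewrite nu.
    apply/eqP => jp; move: nij nu iv; rewrite jp => nij nu /pcol.
    by rewrite e in_setU1 (negPf nij) (negPf nu).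
  apply/col_injP => i i' j /col[[ei ej]|[jp ij]] /col[[ei' ej']|[jp' ij']].
  + by rewrite ei ei'.
  + by rewrite ej eqxx in jp'.
  + by rewrite ej' eqxx in jp.
  + by move/col_injP: cu; apply; [exact: ij|exact: ij'].
move=> i vik; have ui : u i = v i by apply: vu; lia.
by apply: val_inj; rewrite permM ui /= val_adj_swap // !ltn_eqF //; lia.
Qed.

(** Let [p] and [q] be the positions of [k] in [v] and in [u'].  If they differ,
    then [q < p] and the box in row [q] is the only one of column [p] that is
    removed from [v] to [u'].  Every entry of [u'] beyond [k], other than the one in
    position [p], therefore compares with the entry in position [p] as it does in
    [v], where [p] holds the smallest of the values in question; so [u'] has
    [k.+1] in position [p], and undoing the exchange of [k] and [k.+1] puts [k] back
    in position [p]. *)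
Lemma peels_unexchange k v u' : (k < m)%N -> peels k v u' ->
  ~~ peels k.+1 v u' ->
  peels k.+1 v (u' * adj_swap m k)%g && value_desc k (u' * adj_swap m k)%g.
Proof.
move=> km /peelsP[uv cu vu] npeel.
pose p := (v^-1)%g (inord k); pose q := (u'^-1)%g (inord k).
have vp : v p = k :> nat by rewrite permKV inordK //; lia.
have uq : u' q = k :> nat by rewrite permKV inordK //; lia.
have vpE i : (v i == k :> nat) = (i == p).
  by rewrite -vp val_eqE (inj_eq perm_inj).
have uqE i : (u' i == k :> nat) = (i == q).
  by rewrite -uq val_eqE (inj_eq perm_inj).
have uv' := agree_sym vu.
have npq : p != q.
  apply: contra npeel => /eqP pq; apply/peelsP; split=> // i.
  rewrite ltnS leq_eqVlt vpE => /orP[/eqP ->|]; last exact: vu.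
  by apply: val_inj; rewrite /= vp pq uq.
have big i : i != p -> i != q -> (k <= v i)%N || (k <= u' i)%N ->
    (k < v i)%N && (k < u' i)%N.
  rewrite -vpE -uqE => vi ui o.
  have := vu i; have := uv' i; case: (ltnP (v i) k) => a;
    case: (ltnP (u' i) k) => b.
  - lia.
  - by move=> _ /(_ isT) e; move: a b; rewrite e; lia.
  - by move=> /(_ isT) e; move: a b; rewrite e; lia.
  - lia.
have up : (k < u' p)%N.
  rewrite ltn_neqAle eq_sym uqE npq leqNgt; apply/negP => lt.
  by have := uv' _ lt => e; move: lt; rewrite e vp ltnn.
have vq : (k < v q)%N.
  rewrite ltn_neqAle eq_sym vpE eq_sym npq leqNgt; apply/negP => lt.
  by have := vu _ lt => e; move: lt; rewrite -e uq ltnn.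
have qp : (q < p)%N.
  rewrite ltn_neqAle val_eqE eq_sym npq leqNgt; apply/negP => lt.
  have := subsetP uv (p, q); rewrite !mem_Inv lt uq vp up /= => /(_ isT); lia.
pose r := (u'^-1)%g (inord k.+1).
have ur : u' r = k.+1 :> nat by rewrite permKV inordK //; lia.
(* Otherwise the position r of k.+1 gives a second removed box in column p,
   or an inversion of u' that v does not have. *)
have up1 : u' p = k.+1 :> nat.
  apply/eqP; case: eqP => // np.
  have rp : r != p by apply/eqP => rp; apply: np; rewrite -rp.
  have rq : r != q by apply/eqP => rq; move: uq; rewrite -rq; lia.
  have /andP[vr _] : (k < v r)%N && (k < u' r)%N by apply: big => //;
    rewrite ur; lia.
  have lp : (k.+1 < u' p)%N by lia.
  case: (ltngtP r p) => [lt|lt|/val_inj e]; last by rewrite e eqxx in rp.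
    have := col_injP _ cu r q p;
      rewrite !in_setD !mem_Inv lt qp vp vr vq uq ur /=.
    move=> /(_ _ _)/eqP; rewrite (negPf rq) -!leqNgt !(ltnW lp) (ltnW up) /=.
    by move=> H; have := H isT isT.
  have := subsetP uv (p, r); rewrite !mem_Inv lt ur lp vp /= => /(_ isT); lia.
have dv : value_desc k (u' * adj_swap m k)%g.
  rewrite value_desc_adj_swap /adj_swap tpermL tpermR.
  have -> : inord k.+1 = u' p by apply: val_inj; rewrite /= up1 inordK //; lia.
  by rewrite permK.
rewrite dv andbT; have [e ni] := Inv_adj_swap km dv.
move: e ni; rewrite adj_swapK !mul_adj_swapV /adj_swap tpermL tpermR -/q.
have -> : inord k.+1 = u' p by apply: val_inj; rewrite /= up1 inordK //; lia.
rewrite permK -/(adj_swap m k) => e ni.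
have qpv : (q, p) \in Inv v by rewrite mem_Inv qp vp vq.
apply/peelsP; split.
- by rewrite e subUset sub1set qpv.
- apply/col_injP => i i' j; rewrite e !in_setD !in_setU1 !negb_or.
  move=> /andP[/andP[_ a] b] /andP[/andP[_ c] d].
  by apply: (col_injP _ cu i i' j); rewrite in_setD ?a ?c ?b ?d.
move=> i; rewrite ltnS leq_eqVlt vpE permM => /orP[/eqP ->|vik]; apply: val_inj.
  by rewrite /= tpermR vp inordK //; lia.
rewrite (vu _ vik) /= tpermD // -val_eqE /= ?up1 ?inordK; lia.
Qed.

Lemma peels_id k v u : (m <= k)%N -> peels k v u = (u == v).
Proof.
move=> mk; apply/idP/eqP => [/peelsP[_ _ vu]|->]; last first.
  by apply/peelsP; split=> //; apply/col_injP => i i' j; rewrite setDv inE.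
apply/permP => i; have uv := agree_sym vu.
case: (ltnP (v i) k) => [/vu //|a]; case: (ltnP (u i) k) => [/uv //|b].
by apply: val_inj => /=; have := ltn_ord (v i); have := ltn_ord (u i); lia.
Qed.

Variable R : comNzRingType.

(** The coefficients of a decreasing product: a letter [k] is either left out,
    and the value [k] stays in place, or used, and the value [k] moves.  The
    lemmas [peels_exchange] and [peels_unexchange] identify the second case. *)
Lemma dec_prod_sum k (x : R) f v :
  dec_prod k x f v = \sum_(u | peels k v u) x ^+ #|Inv v :\: Inv u| * f u.
Proof.
elim/(@down_ind m): k f => [k mk|k km IH] f.
  rewrite (dec_prod_id _ _ mk) (big_pred1 v) => [|u]; last by rewrite peels_id.
  by rewrite setDv cards0 expr0 mul1r.
rewrite (dec_prod_rec _ _ km) IH [RHS](bigID (peels k.+1 v)) /=.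
under eq_bigr => u _ do rewrite !ffunE mulrDr.
rewrite big_split /=; congr (_ + _).
  apply: eq_bigl => u; rewrite andb_idl // => /peelsP[uv cu vu].
  by apply/peelsP; split=> // i vi; apply: vu; lia.
rewrite [RHS](reindex_inj (mulIg (adj_swap m k))) /=.
rewrite (bigID (value_desc k)) /= addrC big1 ?add0r; last first.
  by move=> u /andP[_ /negPf ->]; rewrite !mulr0.
apply: eq_big => u; last first.
  move=> /andP[/peelsP[uv _ _] du]; rewrite du peels_card // exprSr; ring.
apply/andP/andP => [[pu du]|[pu npu]].
  exact/andP/peels_exchange.
by have /andP := peels_unexchange km pu npu; rewrite adj_swapK.
Qed.

End Peeling.

(** * Schubert polynomials as coefficients *)

Section Coefficients.
Variables (m : nat) (R : comNzRingType) (X : nat -> R).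
Implicit Types (u v w : 'S_m.+1) (i j : 'I_m.+1) (k : nat).

Lemma nilschub_sum k v : nilschub m X k v =
  \sum_(u | peels k v u) X k ^+ #|Inv v :\: Inv u| * nilschub m X k.+1 u.
Proof. by rewrite nilschub_rec dec_prod_sum. Qed.

(** The product uses letters at least [k] only. *)
Lemma nilschub_support k v i : nilschub m X k v != 0 -> (i < k)%N -> v i = i.
Proof.
elim/(@down_ind m): k v i => [k mk|k km IH] v i.
  rewrite nilschub_delta // ffunE; case: (eqVneq v 1%g) => [->|];
    first by rewrite perm1.
  by rewrite eqxx.
rewrite nilschub_sum => nz ik.
have [u /peelsP[_ _ vu] nzu] : exists2 u,
  peels k v u & nilschub m X k.+1 u != 0.
  apply/exists_inP; apply: contraNT nz; rewrite negb_exists_in => /forall_inP z.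
  apply/eqP/big1 => u /z; rewrite negbK => /eqP ->; exact: mulr0.
have ui : u i = i by apply: IH nzu _; lia.
by rewrite -(agree_sym vu) ui.
Qed.

(** The longest permutation fixing the positions below [k]. *)
Definition rev_from k i : 'I_m.+1 :=
  if (i < k)%N then i else inord (m + k - i).

Lemma rev_from_val k i : (k <= m)%N ->
  rev_from k i = (if (i < k)%N then (i : nat) else m + k - i)%N :> nat.
Proof.
move=> km; rewrite /rev_from; case: ltnP => // ki.
by rewrite inordK; lia.
Qed.

Lemma rev_from_inj k : (k <= m)%N -> injective (rev_from k).
Proof.
move=> km i j /(congr1 val) /=; rewrite !rev_from_val // => e.
apply: val_inj => /=; move: e; have := ltn_ord i; have := ltn_ord j.
by case: (ltnP i k); case: (ltnP j k); lia.
Qed.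

Lemma card_ord_gt k : (k <= m)%N ->
  #|[set j : 'I_m.+1 | (k < j)%N]| = (m - k)%N.
Proof.
move=> km; have := cardsC [set j : 'I_m.+1 | (j < k.+1)%N].
rewrite card_ord card_ord_lt // => e.
have -> : [set j : 'I_m.+1 | (k < j)%N] = ~: [set j : 'I_m.+1 | (j < k.+1)%N].
  by apply/setP => j; rewrite !inE -leqNgt.
by lia.
Qed.

(** Only one permutation contributes at each stage: all the boxes of row [k] have
    to be removed, since the remaining permutation fixes [k]; this is already
    one box in every column beyond [k], so the other rows are kept. *)
Lemma nilschub_rev k (km : (k <= m)%N) :
  nilschub m X k (perm (rev_from_inj km)) = \prod_(k <= a < m) X a ^+ (m - a).
Proof.
elim/(@down_ind m): k km => [k mk|k lt IH] km.
  have ek : k = m by lia.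
  rewrite nilschub_delta // ffunE big_geq //.
  (* For k = m the reversed segment is the last position alone. *)
  have -> : perm (rev_from_inj km) = 1%g; last by rewrite eqxx.
  apply/permP => i; rewrite perm1 permE; apply: val_inj => /=.
  by rewrite rev_from_val //; have := ltn_ord i; case: (ltnP i k); lia.
set v := perm _; pose v' := perm (rev_from_inj lt).
have vE i : v i = (if (i < k)%N then (i : nat) else m + k - i)%N :> nat.
  by rewrite permE rev_from_val.
have v'E i : v' i = (if (i < k.+1)%N then (i : nat) else m + k.+1 - i)%N :> nat.
  by rewrite permE rev_from_val.
have InvE i j : ((i, j) \in Inv v) = (i < j)%N && (k <= i)%N.
  rewrite mem_Inv !vE; have := ltn_ord i; have := ltn_ord j.
  by case: (ltnP i k); case: (ltnP j k); lia.
have InvE' i j : ((i, j) \in Inv v') = (i < j)%N && (k < i)%N.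
  rewrite mem_Inv !v'E; have := ltn_ord i; have := ltn_ord j.
  by case: (ltnP i k.+1); case: (ltnP j k.+1); lia.
have dE i j : ((i, j) \in Inv v :\: Inv v') = (i < j)%N && (i == k :> nat).
  by rewrite in_setD InvE InvE'; lia.
rewrite big_ltn // nilschub_sum (bigD1 v') /=; last first.
  apply/peelsP; split.
  - by apply/subsetP => -[i j]; rewrite InvE InvE'; lia.
  - apply/col_injP => i i' j; rewrite !dE => /andP[_ /eqP e] /andP[_ /eqP e'].
    by apply: val_inj; rewrite /= e e'.
  - move=> i; rewrite vE => ik; apply: val_inj; rewrite /= vE v'E.
    by move: ik; have := ltn_ord i; case: (ltnP i k); case: (ltnP i k.+1); lia.
rewrite IH [X in _ + X]big1 ?addr0.
  congr (_ ^+ _ * _); rewrite -(card_ord_gt km).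
  have pI : injective (fun j : 'I_m.+1 =>
    (inord k : 'I_m.+1, j)) by move=> ? ? [].
  rewrite -(card_imset _ pI); apply: eq_card => -[i j]; rewrite dE.
  apply/andP/imsetP => [[ij /eqP ik]|[j' + [-> ->]]].
    by exists j; rewrite ?inE -ik // inord_val.
  by rewrite inE inordK // ltnS km eqxx => ->.
move=> u /andP[/peelsP[uv cu vu] nu]; apply/eqP; apply: contraNT nu => nz.
have nzu : nilschub m X k.+1 u != 0 by apply: contraNneq nz => ->;
  rewrite mulr0.
have fix_u := nilschub_support nzu.
apply/eqP/Inv_inj/setP => -[i j]; rewrite InvE'.
case: (ltnP i j) => [ij|ji] /=; last by rewrite mem_Inv ltnNge ji.
case: (ltnP k i) => ki; last first.
  rewrite mem_Inv ij /= (fix_u i) //; apply/negbTE; rewrite -leqNgt.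
  case: (ltnP j k.+1) => jk; first by rewrite fix_u // ltnW.
  rewrite leqNgt; apply/negP => uj.
  have e : u (u j) = u j by apply: fix_u; exact: leq_trans uj (leqW ki).
  by move: uj; rewrite (perm_inj e) ltnNge (ltnW ij).
apply/negPn/negP => nij.
have kin : (inord k : 'I_m.+1) = k :> nat by rewrite inordK //; lia.
have := col_injP _ cu i (inord k) j; rewrite !in_setD nij !InvE ij (ltnW ki) /=.
rewrite kin leqnn (ltn_trans ki ij) !andbT mem_Inv negb_and.
rewrite (fix_u (inord k)) ?kin //.
have -> : ~~ (u j < k)%N.
  rewrite -leqNgt leqNgt; apply/negP => uj.
  have e : u (u j) = u j by apply: fix_u; exact: leqW.
  by move: uj; rewrite (perm_inj e) ltnNge (ltnW (ltn_trans ki ij)).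
by rewrite orbT => /(_ isT isT) e; move: ki; rewrite e kin ltnn.
Qed.

End Coefficients.

Section SchubertCoefficients.
Variable m : nat.

Definition Xvar (k : nat) : {mpoly int[m.+1]} := 'X_(inord k).

Lemma schubert_nilschub (w : 'S_m.+1) : schubert w = nilschub m Xvar 0 w.
Proof.
rewrite /schubert; set S := xchoose _.
suff -> : S = nilschub m Xvar 0 by [].
apply: (schubert_family_uniq (schubertP m.+1)).
apply/andP; split.
  have -> : w0 m.+1 = perm (rev_from_inj (leq0n m)).
    apply/permP => i; rewrite !permE; apply: val_inj.
    rewrite /= rev_from_val //=; lia.
  rewrite nilschub_rev; apply/eqP;
    rewrite big_mkord big_ord_recr /= subnn expr0 mulr1.
  apply: eq_bigr => i _; congr (_ ^+ _); rewrite /Xvar; congr 'X_ _.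
    by apply: val_inj; rewrite /= inordK //; have := ltn_ord i; lia.
apply/forallP => v; apply/forallP => i; apply/forallP => j;
  apply/implyP => /eqP ij.
apply/eqP/divdiff_uniq; first exact: adj_neq.
have Xi (a : 'I_m.+1) : Xvar a = 'X_a by rewrite /Xvar inord_val.
have sX a : msym (tperm i j) (Xvar a) =
  'X_(tperm i j (inord a)) by exact: msymXU.
have := @nilschub_divided_difference m _ (msym (tperm i j)) Xvar i j 0 ij.
rewrite /= !sX !inord_val tpermL tpermR => D.
have {}D := D (esym (Xi j)) (esym (Xi i)).
have Xa a : (a < m)%N -> a != i -> a != j ->
    'X_(tperm i j (inord a)) = Xvar a.
  move=> am ai aj; rewrite tpermD // -val_eqE /= inordK 1?eq_sym //; lia.
have /ffunP/(_ v) := D (fun a am ai aj => etrans (sX a) (Xa a am ai aj)) isT.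
 rewrite !Xi !ffunE len_swap // => {1}->.
by rewrite /= [in RHS]addrC addKr.
Qed.

End SchubertCoefficients.

(** * Balanced fillings *)

(** Comparing the median with a threshold amounts to counting the entries that
    reach the threshold, which turns a balance condition into a condition on
    0/1 diagrams. *)
Lemma leq_median s c : (0 < size s)%N ->
  (c <= median s)%N = (size s - (size s)./2 <= count (leq c) s)%N.
Proof.
move=> s0; rewrite /median -(count_sort leq) -(size_sort leq s).
have : (0 < size (sort leq s))%N by rewrite size_sort.
have : sorted leq (sort leq s) by apply: sort_sorted; exact: leq_total.
move: (sort leq s) => {s0}s st s0; set d := (size s)./2.
have ds : (d < size s)%N by rewrite /d; lia.
have mono a b : (a <= b)%N -> (b < size s)%N -> (nth 0 s a <= nth 0 s b)%N.
  move=> ab bs; apply: (sorted_leq_nth leq_trans leqnn 0%N st) => //.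
  by rewrite inE; lia.
case: leqP => cd; apply/esym.
  rewrite -{2}(cat_take_drop d s) count_cat.
  have /eqP -> : count (leq c) (drop d s) == size (drop d s).
    rewrite -all_count; apply/(all_nthP 0%N) => a;
      rewrite size_drop nth_drop => ad.
    by apply: leq_trans cd _; apply: mono; lia.
  by rewrite size_drop leq_addl.
apply/negbTE; rewrite -ltnNge -(cat_take_drop d.+1 s) count_cat.
have /eqP -> : count (leq c) (take d.+1 s) == 0%N.
  rewrite -leqn0 leqNgt -has_count; apply/(has_nthP 0%N) => -[a].
  rewrite size_takel // => ad; rewrite nth_take // leqNgt.
  by rewrite (leq_ltn_trans (mono a d _ _) cd).
rewrite add0n (leq_ltn_trans (count_size _ _)) // size_cat size_drop.
by rewrite size_takel //; lia.
Qed.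

Section Balanced.
Variable n : nat.
Implicit Types (T : filling n) (i j k : 'I_n) (c : nat).

Definition inside i j : {set 'I_n} := [set x : 'I_n | (i < x < j)%N].

Definition hook_row T c i j := [set x in inside i j | (c <= T i x)%N].
Definition hook_col T c i j := [set x in inside i j | (c <= T x j)%N].

Lemma count_enum_ord (p : pred 'I_n) : count p (enum 'I_n) = #|[set x | p x]|.
Proof. by rewrite cardsE cardE -size_filter /enum_mem -enumT filter_predT. Qed.

Lemma size_hook T i j : size (hook T i j) = (#|inside i j|.*2).+1.
Proof.
by rewrite /= size_cat !size_map !size_filter !count_enum_ord addnn.
Qed.

Lemma count_entries (p : pred nat) (q : pred 'I_n) (f : 'I_n -> nat) :
  count p [seq f x | x <- enum 'I_n & q x] = #|[set x | q x & p (f x)]|.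
Proof.
rewrite count_map count_filter count_enum_ord; apply: eq_card => x.
by rewrite !inE andbC.
Qed.

Lemma count_hook T c i j : count (leq c) (hook T i j) =
  ((c <= T i j) + (#|hook_col T c i j| + #|hook_row T c i j|))%N.
Proof.
rewrite /= count_cat !count_entries.
by congr (_ + (_ + _))%N; apply: eq_card => x; rewrite !inE.
Qed.

Lemma weakly_balancedP T :
  reflect (forall i j, (i < j)%N -> forall c, (c <= T i j)%N =
     (#|inside i j| < (c <= T i j) + (#|hook_col T c i j| + #|hook_row T c i
       j|))%N)
    (weakly_balanced T).
Proof.
have med i j c : (c <= median (hook T i j))%N =
    (#|inside i j| < (c <= T i j) + (#|hook_col T c i j| + #|hook_row T c i
      j|))%N.
  rewrite leq_median ?size_hook // count_hook /= uphalf_double.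
  by congr (_ <= _)%N; lia.
apply: (iffP forallP) => H i.
  by move=> j ij c; have /forallP/(_ j)/implyP/(_ ij)/eqP e := H i;
    rewrite -med -e.
apply/forallP => j; apply/implyP => ij; apply/eqP/eqP; rewrite eqn_leq.
have := H i j ij (T i j); have := H i j ij (median (hook T i j)).
by rewrite -!med !leqnn => -> <-.
Qed.

(** For an inversion set seen as a 0/1 diagram this is biconvexity; for a
    filling it is biconvexity at every threshold. *)
Definition between T := forall i j k, (i < j)%N -> (j < k)%N ->
  (minn (T i j) (T j k) <= T i k <= maxn (T i j) (T j k))%N.

(** A hook pairs the boxes [(i, x)] and [(x, j)]; as the corner lies between the
    entries of each pair, it is the median. *)
Lemma between_weakly_balanced T : between T -> weakly_balanced T.
Proof.
move=> bt; apply/weakly_balancedP => i j ij c.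
case: (leqP c (T i j)) => cT; apply/esym.
  rewrite add1n ltnS; apply: leq_trans (leq_card_setU _ _).
  apply/subset_leq_card/subsetP => x xij; rewrite !inE.
  move: (xij); rewrite inE => /andP[ix xj].
  by have := bt i x j ix xj; rewrite ix xj /=; lia.
apply/negbTE; rewrite -leqNgt add0n -cardsUI.
have -> : hook_col T c i j :&: hook_row T c i j = set0.
  apply/setP => x; rewrite !inE; case: (ltnP i x) => // ix.
  case: (ltnP x j) => // xj; have := bt i x j ix xj => /=; lia.
rewrite cards0 addn0; apply/subset_leq_card/subsetP => x; rewrite !inE.
by case/orP => /andP[].
Qed.

(** Induction on the size of the hook, at each threshold [c].  Let [P] consist of
    the [x] whose row entry [T i x] reaches [c], and [Q] of those whose column
    entry [T x k] does not.  The induction hypothesis makes [P] and [Q]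
    comparable for inclusion: an element of [P] outside [Q] and an element of [Q]
    outside [P] would violate biconvexity.  The majority condition compares the
    cardinals of [P] and [Q], hence decides which inclusion holds, and this
    inclusion is the claim for every [x]. *)
Lemma weakly_balanced_between T : weakly_balanced T -> between T.
Proof.
move=> /weakly_balancedP bal i j k.
have [d] := ubnP (k - i); elim: d i j k => // d IH i j k lt ij jk.
have level c : ((c <= T i j) -> (c <= T j k) -> (c <= T i k))%N /\
               ((c <= T i k) -> (c <= T i j) || (c <= T j k))%N.
  have := bal i k (ltn_trans ij jk) c.
  set P := hook_row T c i k; set Q := inside i k :\: hook_col T c i k.
  have cQ : (#|Q| + #|hook_col T c i k| = #|inside i k|)%N.
    rewrite -(cardsID (hook_col T c i k) (inside i k)) addnC;
      congr (#|pred_of_set _| + _)%N.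
    by apply/setP => x; rewrite !inE; case: (i < x)%N; case: (x < k)%N;
      case: (c <= _)%N.
  have jM : j \in inside i k by rewrite inE ij jk.
  have nested : P \subset Q \/ Q \subset P.
    case: (boolP (P \subset Q)); first by left.
    case/subsetPn => x xP xQ; right; apply/subsetP => y yQ;
      apply/negPn/negP => yP.
    move: xP xQ yQ yP; rewrite !inE.
    case: (ltnP i x) => //= ix; case: (ltnP x k) => //= xk xP;
      rewrite andbT negbK => xQ.
    case: (ltnP i y) => //= iy; case: (ltnP y k) => //= yk;
      rewrite andbT => yQ yP.
    case: (ltngtP x y) => [xy|yx|/val_inj e].
    - have := IH i x y _ ix xy; have := IH x y k _ xy yk; lia.
    - have := IH i y x _ iy yx; have := IH y x k _ yx xk; lia.
    - by move: yP; rewrite -e xP.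
  case: (leqP c (T i k)) => cT /esym card; split=> //.
    move=> _; have le : (#|Q| <= #|P|)%N by move: card; rewrite -cQ; lia.
    have QP : Q \subset P.
      by case: nested => // PQ; have/eqP -> : P == Q by rewrite eqEcard PQ.
    have := subsetP QP j; rewrite !inE ij jk /= andbT.
    by case: (c <= T j k)%N => /=; rewrite ?orbT ?orbF // => ->.
  have le : (#|P| <= #|Q|)%N by move: card; rewrite -cQ; lia.
  have PQ : P \subset Q.
    by case: nested => // QP; have/eqP -> : Q == P by rewrite eqEcard QP.
  by have := subsetP PQ j; rewrite !inE ij jk /= andbT => H /H /negP.
have [lo _] := level (minn (T i j) (T j k)); have [_ hi] := level (T i k).
move: lo hi; lia.
Qed.

End Balanced.

(** * Erasing the smallest entries of a tableau *)

Section Tableaux.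
Variable m : nat.
Implicit Types (u v w : 'S_m.+1) (i j l : 'I_m.+1) (k : nat).
Implicit Types T : filling m.+1.

(** The tableaux left after the entries up to [k] have been erased. *)
Definition IT_above k w : {set filling m.+1} :=
  [set T in IT w | [forall i : 'I_m.+1, forall j : 'I_m.+1,
                      (0 < T i j)%N ==> (k < T i j)%N]].

Lemma IT_aboveP k w T :
  reflect [/\ forall i j, (0 < T i j)%N = ((i, j) \in Inv w), between T,
    forall i i' j, (0 < T i j)%N -> T i j = T i' j -> i = i',
    forall i j, j = i.+1 :> nat -> (T i j <= i.+1)%N &
    forall i j, (0 < T i j)%N -> (k < T i j)%N] (T \in IT_above k w).
Proof.
have E i j : inversion w i j = ((i, j) \in Inv w) by rewrite inE.
rewrite !inE; apply: (iffP andP).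
  move=> [/and4P[sh bal col fl] ab].
  have S i j : (0 < T i j)%N = ((i, j) \in Inv w).
    move/forallP/(_ i)/forallP/(_ j): sh; rewrite E; case: ifP => //.
    by move=> _ /eqP ->.
  split=> //.
  - exact: weakly_balanced_between.
  - move=> i i' j T0 e; apply/eqP/negPn/negP => ii'.
    move/forallP/(_ i)/forallP/(_ i')/forallP/(_ j): col.
    by rewrite !E -!S -e T0 ii' eqxx.
  - move=> i j ij; move/forallP/(_ i)/forallP/(_ j): fl.
    by rewrite ij eqxx.
  - by move=> i j; move/forallP/(_ i)/forallP/(_ j)/implyP: ab.
move=> [S bt col fl ab]; split; last first.
  by apply/forallP => i; apply/forallP => j; apply/implyP; exact: ab.
apply/and4P; split.
- apply/forallP => i; apply/forallP => j; rewrite E -S.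
  by case: ifP => //; case: (T i j : nat).
- exact: between_weakly_balanced.
- apply/forallP => i; apply/forallP => i'; apply/forallP => j; apply/implyP.
  rewrite !E -!S => /and3P[T0 _]; apply: contra => /eqP e; apply/eqP.
  exact: col e.
- apply/forallP => i; apply/forallP => j; apply/implyP => /eqP; exact: fl.
Qed.

Lemma IT_above0 w : IT_above 0 w = IT w.
Proof.
apply/setP => T; rewrite inE andb_idr // => _.
by apply/forallP => i; apply/forallP => j; apply/implyP.
Qed.

Definition level k T : {set 'I_m.+1 * 'I_m.+1} := [set p | (k < T p.1 p.2)%N].

Definition erase_upto k T : filling m.+1 :=
  \matrix_(i, j) if (k.+1 < T i j)%N then T i j else ord0.

Definition fill_with k v T : filling m.+1 :=
  \matrix_(i, j) if (T i j == 0%N :> nat) && ((i, j) \in Inv v)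
                 then inord k.+1 else T i j.

(** The effect on shapes of erasing the entries equal to [k.+1]; the last
    condition is what the flag condition requires of these entries, rows being
    counted from 0. *)
Definition flagged_peels k v u : bool :=
  [&& Inv u \subset Inv v, col_inj (Inv v :\: Inv u)
    & [forall i : 'I_m.+1, forall j : 'I_m.+1,
        (j == i.+1 :> nat) && ((i, j) \in Inv v :\: Inv u) ==> (k <= i)%N]].

Lemma flagged_peelsP k v u :
  reflect [/\ Inv u \subset Inv v, col_inj (Inv v :\: Inv u)
    & forall i j, j = i.+1 :> nat -> (i, j) \in Inv v :\: Inv u -> (k <= i)%N]
    (flagged_peels k v u).
Proof.
apply: (iffP and3P) => -[? ? H]; split=> //.
  move=> i j /eqP ij iv; move/forallP/(_ i)/forallP/(_ j)/implyP: H; apply.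
  by rewrite ij.
apply/forallP => i; apply/forallP => j; apply/implyP => /andP[/eqP]; exact: H.
Qed.

Lemma fill_withE k v T i j : (k <= m)%N -> fill_with k v T i j =
  (if (T i j == 0%N :> nat) && ((i, j) \in Inv v) then k.+1 else T i j) :> nat.
Proof. by move=> km; rewrite mxE; case: ifP => // _; rewrite inordK. Qed.

Lemma erase_uptoE k T i j :
  erase_upto k T i j = (if (k.+1 < T i j)%N then (T i j : nat) else 0%N) :> nat.
Proof. by rewrite mxE; case: ifP. Qed.

(** The level sets of a balanced filling are biconvex. *)
Lemma level_perm k v T : T \in IT_above k v -> exists u, Inv u = level k.+1 T.
Proof.
move=> /IT_aboveP[S bt _ _ _]; apply: biconvex_perm => [i j|i j l ij jl].
  rewrite inE /= => Tij.
  have T0 : (0 < T i j)%N by lia.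
  by move: T0; rewrite S mem_Inv => /andP[].
by have := bt i j l ij jl; rewrite !inE /=; split; lia.
Qed.

Lemma fill_erase k v T : (k <= m)%N -> T \in IT_above k v ->
  fill_with k v (erase_upto k T) = T.
Proof.
move=> km /IT_aboveP[S bt _ _ ab]; apply/matrixP => i j; apply: val_inj => /=.
by rewrite fill_withE // erase_uptoE -S; have := ab i j; do 2!case: ifP; lia.
Qed.

Lemma erase_fill k v u T : (k <= m)%N -> T \in IT_above k.+1 u ->
  erase_upto k (fill_with k v T) = T.
Proof.
move=> km /IT_aboveP[S bt _ _ ab]; apply/matrixP => i j; apply: val_inj => /=.
by rewrite erase_uptoE fill_withE //; have := ab i j; do 2!case: ifP; lia.
Qed.

Lemma erase_IT_above k v u T : T \in IT_above k v -> Inv u = level k.+1 T ->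
  erase_upto k T \in IT_above k.+1 u /\ flagged_peels k v u.
Proof.
move=> /IT_aboveP[S bt col fl ab] e.
have uE i j : ((i, j) \in Inv u) = (k.+1 < T i j)%N by rewrite e inE.
have dE i j : (i, j) \in Inv v :\: Inv u -> T i j = k.+1 :> nat.
  by rewrite in_setD uE -S => /andP[]; have := ab i j; lia.
split.
  apply/IT_aboveP; split.
  - by move=> i j; rewrite uE erase_uptoE; case: ifP; lia.
  - move=> i j l ij jl; have := bt i j l ij jl; rewrite !erase_uptoE.
    by do 3!case: ifP; lia.
  - move=> i i' j; rewrite erase_uptoE => T0 /(congr1 val) /=;
    rewrite !erase_uptoE.
    move=> e'; apply: (col i i' j); first by move: T0; case: ifP; lia.
    by apply: val_inj => /=; move: T0 e'; do 2!case: ifP; lia.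
  - by move=> i j /fl; rewrite erase_uptoE; case: ifP.
  - by move=> i j; rewrite erase_uptoE; case: ifP.
apply/flagged_peelsP; split.
- by apply/subsetP => -[i j]; rewrite uE -S; lia.
- apply/col_injP => i i' j /dE a /dE b; apply: (col i i' j); first by rewrite a.
  by apply: val_inj; rewrite /= a b.
- by move=> i j /fl + /dE a; rewrite a; lia.
Qed.

Lemma fill_IT_above k v u T : (k <= m)%N -> T \in IT_above k.+1 u ->
  flagged_peels k v u ->
  fill_with k v T \in IT_above k v /\ Inv u = level k.+1 (fill_with k v T).
Proof.
move=> km /IT_aboveP[S bt col fl ab] /flagged_peelsP[uv cu fu].
have Sv i j : (0 < T i j)%N -> (i, j) \in Inv v.
  by rewrite S => /(subsetP uv).
split; last first.
  apply/setP => -[i j]; rewrite [RHS]inE /= fill_withE // -S.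
  by have := ab i j; case: ifP; lia.
have D i j : (T i j == 0%N :> nat) -> (i, j) \in Inv v ->
  (i, j) \in Inv v :\: Inv u.
  by move=> T0 ijv; rewrite in_setD ijv andbT -S; lia.
apply/IT_aboveP; split.
- move=> i j; rewrite fill_withE //; have := Sv i j;
  case: ifP => [/andP[_ ->] //|].
  by case: ((i, j) \in _); lia.
- move=> i j l ij jl; rewrite !fill_withE //; have := bt i j l ij jl.
  have [] := biconvex_Inv v ij jl; have := Sv i j; have := Sv j l;
    have := Sv i l.
  have := ab i j; have := ab j l; have := ab i l.
  case: ((i, j) \in _); case: ((j, l) \in _); case: ((i, l) \in _);
    rewrite ?andbT ?andbF; move: (T i j : nat) (T j l : nat) (T i l : nat) =>
      a b c;
    case: (eqVneq a 0%N); case: (eqVneq b 0%N); case: (eqVneq c 0%N) => /=; lia.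
- move=> i i' j F0 /(congr1 val) /=; move: F0; rewrite !fill_withE //.
  have := ab i j; have := ab i' j.
  case: ifP => [/andP[T'0 v']|_]; case: ifP => [/andP[T0 v0]|_] //.
  + by move=> _ _ _ _; apply: (col_injP _ cu i i' j); exact: D.
  + by lia.
  + by lia.
  + by move=> _ _ T0 e; apply: (col i i' j) => //; apply: val_inj.
- move=> i j ij; rewrite fill_withE //; case: ifP => [/andP[T0 v0]|_];
  last exact: fl.
  by rewrite ltnS; apply: (fu i j ij); exact: D.
- move=> i j; rewrite fill_withE //; have := ab i j; case: ifP => //; lia.
Qed.

Lemma xwt_fill k v u T : (k < m)%N -> T \in IT_above k.+1 u ->
  Inv u \subset Inv v ->
  xwt (fill_with k v T) = Xvar m k ^+ #|Inv v :\: Inv u| * xwt T.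
Proof.
move=> km /IT_aboveP[S bt col fl ab] uv.
have kv : (inord k : 'I_m.+1) = k :> nat by rewrite inordK //; lia.
rewrite /xwt (bigD1 (inord k)) /=; last by rewrite kv; lia.
rewrite [in RHS](bigD1 (inord k)) /=; last by rewrite kv; lia.
have -> : wt T (inord k : 'I_m.+1).+1 = 0%N.
  apply/eqP; rewrite cards_eq0; apply/eqP/setP => -[i j]; rewrite !inE /= kv.
  by have := ab i j; lia.
rewrite expr0 mul1r; congr (_ ^+ _ * _).
  apply: eq_card => -[i j]; rewrite in_setD -S inE /= fill_withE ?kv;
    last by lia.
  have := ab i j; case: ((i, j) \in _); rewrite ?andbT ?andbF; last by lia.
  by case: ifP; lia.
apply: eq_bigr => i /andP[_ ik]; congr (_ ^+ _).
have {}ik : i != k :> nat by rewrite -kv.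
apply: eq_card => -[a b]; rewrite !inE /= fill_withE; last by lia.
by case: ifP; lia.
Qed.

(** Erasing the entries [k.+1] is inverted by filling the boxes that have
    disappeared from the shape. *)
Lemma sum_IT_step k v : (k < m)%N ->
  \sum_(T in IT_above k v) xwt T =
  \sum_(u | flagged_peels k v u) Xvar m k ^+ #|Inv v :\: Inv u| *
     \sum_(T in IT_above k.+1 u) xwt T.
Proof.
move=> km; pose p T : 'S_m.+1 := odflt 1%g [pick u | Inv u == level k.+1 T].
have pE T : T \in IT_above k v -> Inv (p T) = level k.+1 T.
  move=> /level_perm[u eu]; rewrite /p; case: pickP => [x /eqP //|/(_ u)].
  by rewrite eu eqxx.
rewrite (partition_big p (flagged_peels k v)) => [|T TI]; last first.
  by have [] := erase_IT_above TI (pE _ TI).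
apply: eq_bigr => u su; rewrite big_distrr /=.
rewrite (reindex_onto (fill_with k v) (erase_upto k)) /=; last first.
  by move=> T /andP[TI _]; apply: fill_erase => //; exact: ltnW.
apply: eq_big => T.
  apply/idP/idP => [/andP[/andP[TI /eqP pu] /eqP e]|TI].
    by rewrite -e; have [] := @erase_IT_above k v u _ TI; rewrite -?pE ?pu.
  have [FI e] := fill_IT_above (ltnW km) TI su.
  by rewrite FI (erase_fill _ (ltnW km) TI) eqxx andbT; apply/eqP/Inv_inj;
    rewrite pE.
move=> /andP[/andP[TI /eqP pu] /eqP e]; apply: xwt_fill => //.
  by rewrite -e; have [] := @erase_IT_above k v u _ TI; rewrite -?pE ?pu.
by case/flagged_peelsP: su.
Qed.

Lemma ascending_prefix k v :
  (forall i j, j = i.+1 :> nat -> (j <= k)%N -> (v i < v j)%N) ->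
  forall i j, (i < j)%N -> (j <= k)%N -> (v i < v j)%N.
Proof.
move=> asc i j; have [d] := ubnP (j - i); elim: d j => // d IH j lt ij jk.
have j1 : (j.-1 < m.+1)%N by have := ltn_ord j; lia.
have ej : j = (Ordinal j1).+1 :> nat by rewrite /=; lia.
have := asc _ _ ej jk; case: (eqVneq i (Ordinal j1)) => [-> //|ne].
have ne' : i != j.-1 :> nat by rewrite -val_eqE in ne.
by have := IH (Ordinal j1); rewrite /= => H;
  have := H ltac:(lia) ltac:(lia) ltac:(lia); lia.
Qed.

(** Suppose that [u] fixes the positions up to [k].  The flag condition then says
    that the entries of [v] increase up to position [k].  A box of [v] in a row
    [i < k] would have to lie in a column beyond [k], where it comes with a box
    in row [k]; both are removed, against injectivity in columns.  So [v]
    fixes the positions below [k]. *)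
Lemma flagged_peelsE k v u : (k <= m)%N -> (forall i, (i <= k)%N -> u i = i) ->
  flagged_peels k v u = peels k v u.
Proof.
move=> km fu.
have ubig j : (k < j)%N -> (k < u j)%N.
  move=> kj; rewrite ltnNge; apply/negP => uj.
  by have := fu _ uj => /perm_inj e; move: uj; rewrite e leqNgt kj.
have nInv i j : (i <= k)%N -> (i, j) \notin Inv u.
  move=> ik; rewrite mem_Inv (fu i ik); case: (leqP j k) => jk.
    by rewrite fu //; lia.
  by have := ubig j jk; lia.
apply/flagged_peelsP/peelsP => -[uv cu H]; split=> //.
  have asc : forall i j, (i < j)%N -> (j <= k)%N -> (v i < v j)%N.
    apply: ascending_prefix => i j ij jk; rewrite perm_ltn {1}ij ltnSn.
    apply/negP => ijv; have := H i j ij; rewrite in_setD ijv nInv; last by lia.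
    by move=> /(_ isT); lia.
  have asc' i j : (i < k)%N -> (i < j)%N -> (v i < v j)%N.
    move=> ik ij; case: (leqP j k) => jk; first exact: asc.
    rewrite perm_ltn ij; apply/negP => ijv.
    have kin : (inord k : 'I_m.+1) = k :> nat by rewrite inordK.
    have := col_injP _ cu i (inord k) j; rewrite !in_setD ijv !nInv ?kin //;
      last by lia.
    rewrite mem_Inv kin jk /=; move: ijv; rewrite mem_Inv ij /= => vij.
    have := asc i (inord k); rewrite kin => /(_ ik (leqnn _)) vik.
    rewrite (ltn_trans vij vik) => /(_ isT isT) e.
    by move: ik; rewrite e kin ltnn.
  have fv i : (i < k)%N -> v i = i.
    move=> ik; apply: val_inj; rewrite /= -perm_rank.
    rewrite -[RHS](card_ord_lt (ltnW (ltn_ord i))); apply: eq_card => j.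
    rewrite !inE; case: (ltngtP j i) => [ji|ij|/val_inj ->];
      last by rewrite ltnn.
      by apply: asc => //; lia.
    by apply/negbTE; rewrite -leqNgt ltnW // asc'.
  move=> i vik; have e : v (v i) = v i by apply: fv.
  by move/perm_inj: e vik => ->; move=> ik; rewrite fu // ltnW.
move=> i j ij; rewrite in_setD !mem_Inv => /andP[_ /andP[_ vji]].
rewrite leqNgt; apply/negP => ik.
have ui : u i = i by apply: fu; lia.
have vi : v i = i by rewrite -(agree_sym H) ui.
have uj : u j = j by apply: fu; lia.
have := H j; rewrite uj => e; have vjk : (v j < k)%N by rewrite -vi in ik; lia.
by move: vji; rewrite -e // vi; lia.
Qed.

(** Tableaux and coefficients satisfy the same recursion: the conditions
    [flagged_peels] and [peels] only differ for permutations [u] whose coefficient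
    vanishes by [nilschub_support]. *)
Lemma sum_IT_above k v : (k <= m)%N ->
  \sum_(T in IT_above k v) xwt T = nilschub m (Xvar m) k v.
Proof.
elim/(@down_ind m): k v => [k mk|k km IH] v lkm.
  have ek : k = m by lia.
  rewrite {}ek {k mk lkm} nilschub_delta // ffunE.
  have T0 T : T \in IT_above m v -> v = 1%g /\ T = const_mx ord0.
    move=> /IT_aboveP[S bt col fl ab].
    have v1 : v = 1%g.
      have asc : forall i j, (i < j)%N -> (j <= m)%N -> (v i < v j)%N.
        apply: ascending_prefix => i j ij jk; rewrite perm_ltn {1}ij ltnSn -S.
        by have := ab i j; have := fl i j ij; lia.
      apply: Inv_inj; apply/setP => -[i j]; rewrite !mem_Inv !perm1.
      case: (ltnP i j) => //= ij; have := asc i j ij; rewrite -ltnS ltn_ord.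
      by move=> /(_ isT); lia.
    split=> //; apply/matrixP => i j; rewrite mxE; apply: val_inj => /=.
    have := S i j; rewrite v1 mem_Inv !perm1; lia.
  case: (eqVneq v 1%g) => [v1|nv]; last first.
    by rewrite big_pred0 // => T; apply/negbTE/negP => /T0[e];
      rewrite e eqxx in nv.
  rewrite (big_pred1 (const_mx ord0)) => [|T].
    rewrite /xwt big1 // => i _; rewrite (_ : wt _ _ = 0%N) ?expr0 //.
    by apply/eqP; rewrite cards_eq0; apply/eqP/setP => p; rewrite !inE mxE.
  apply/idP/eqP => [/T0[] //|->]; apply/IT_aboveP; split.
  - move=> i j; rewrite mxE v1 mem_Inv !perm1 /=;
    move: (i : nat) (j : nat) => a b; lia.
  - by move=> i j l _ _; rewrite !mxE.
  - by move=> i i' j; rewrite mxE.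
  - by move=> i j _; rewrite mxE.
  - by move=> i j; rewrite mxE.
rewrite sum_IT_step // nilschub_sum.
rewrite [LHS]big_mkcond [RHS]big_mkcond; apply: eq_bigr => u _.
rewrite IH //; case: (eqVneq (nilschub m (Xvar m) k.+1 u) 0) => [->|nz].
  by rewrite mulr0 !if_same.
by rewrite flagged_peelsE // => i ik; apply: (nilschub_support nz).
Qed.

End Tableaux.

Theorem theorem3p13 (n : nat) (w : 'S_n) :
  schubert w = \sum_(T in IT w) xwt T.
Proof.
(* Letters and variables with natural indices are read in 'I_m.+1, so the empty
   permutation is apart; there both sides are 1. *)
case: n w => [|m] w; last by rewrite schubert_nilschub -IT_above0 sum_IT_above.
have /andP[/eqP S0 _] := schubertP 0.
have perm0 (u v : 'S_0) : u = v by apply/permP => -[].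
rewrite /schubert (perm0 w (w0 0)) S0 big_ord0.
have T0 (T T' : filling 0) : T = T' by apply/matrixP => -[].
rewrite (big_pred1 (const_mx ord0)) => [|T]; first by rewrite /xwt big_ord0.
apply/idP/eqP => _; first exact: T0.
by rewrite inE; apply/and4P; split; apply/forallP => -[].
Qed.
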